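(* Let $d\ge3$ and let $W_1,\dots,W_d$ be complex vector spaces of dimensions $n_1,\dots,n_d$, each at least two. (i) The set of rank-one complex tensors has fundamental group $$\pi_1\bigl(\{A\in W_1\otimes\cdots\otimes W_d:\operatorname{rank}(A)=1\}\bigr)=0.$$ (ii) Let $n_1\le\cdots\le n_d$ and $(n_1-1)+\cdots+(n_{d-2}-1)>1$. Then the set of rank-two identifiable complex tensors has fundamental group $$\pi_1\bigl(\{A\in W_1\otimes\cdots\otimes W_d:\operatorname{rank}(A)=2,\ A\text{ is identifiable}\}\bigr)=\mathbb{Z}/2\mathbb{Z}.$$
   Context: All sets carry the Euclidean topology. $\operatorname{rank}(A)$ is the least $r\in\{0,1,2,\dots\}$ such that $A=\sum_{i=1}^r v_{1,i}\otimes\cdots\otimes v_{d,i}$ with $v_{j,i}\in W_j$. A rank-$r$ tensor $A$ is identifiable if it has a unique rank-$r$ decomposition, i.e. the set $\{x_1,\dots,x_r\}$ of rank-one tensors with $A=x_1+\cdots+x_r$ is unique (up to reordering the summands). *)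

(* Defs.v *)
From HB Require Import structures.
From mathcomp Require Import all_boot all_order all_algebra generic_quotient.
From mathcomp Require Import complex.
From mathcomp Require Import all_classical all_reals all_analysis homotopy.
From mathcomp Require Import ring lra.

Set Implicit Arguments.
Unset Strict Implicit.
Unset Printing Implicit Defensive.

Import Order.TTheory GRing.Theory Num.Theory numFieldNormedType.Exports.

Local Open Scope classical_set_scope.
Local Open Scope ring_scope.
Local Open Scope quotient_scope.
Local Open Scope complex_scope.

Section pasting.
Context {S T : topologicalType} {R : realType}.

Lemma pasting (h : S -> R) (c : R) (f g : S -> T) :
  continuous h -> continuous f -> continuous g ->
  (forall s, h s = c -> f s = g s) ->
  continuous (fun s => if h s <= c then f s else g s).
Proof.
move=> ch cf cg fg; apply/continuous_subspace_setT.
have -> : [set: S] = [set s | h s <= c] `|` [set s | c <= h s].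
  by apply/seteqP; split=> // s _; exact/orP/le_total.
apply: withinU_continuous.
- exact: (closed_comp (fun x _ => ch x) (@closed_le _ c)).
- exact: (closed_comp (fun x _ => ch x) (@closed_ge _ c)).
- apply: (@subspace_eq_continuous _ _ _ f); last exact: continuous_subspaceT.
  by move=> s /set_mem /= hs; rewrite /from_subspace hs.
- apply: (@subspace_eq_continuous _ _ _ g); last exact: continuous_subspaceT.
  move=> s /set_mem /= cs; rewrite /from_subspace; case: ifPn => // sc.
  by rewrite fg//; apply/eqP; rewrite eq_le sc.
Qed.

End pasting.

Section unit_interval.
Context {R : realType}.

Definition unit_interval : Type := set_type (`[0, 1]%classic : set R).

HB.instance Definition _ := Topological.on unit_interval.

Definition clamp_fun (x : R) : R := Num.max 0 (Num.min x 1).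

Lemma clamp_subproof (x : R) : clamp_fun x \in `[0, 1]%classic.
Proof.
rewrite inE /= in_itv /= /clamp_fun le_max lexx /= ge_max ler01 /=.
by rewrite ge_min lexx orbT.
Qed.

Definition clamp (x : R) : unit_interval :=
  exist _ (clamp_fun x) (clamp_subproof x).

Definition uval (t : unit_interval) : R := set_val t.

Lemma uval_itv (t : unit_interval) : 0 <= uval t <= 1.
Proof. by have := set_valP t; rewrite /uval /= in_itv. Qed.

Lemma clampE (x : R) : 0 <= x <= 1 -> uval (clamp x) = x.
Proof.
move=> /andP[x0 x1]; rewrite /uval set_valE /= /clamp_fun min_l//.
by rewrite max_r.
Qed.

Lemma clampK (t : unit_interval) : clamp (uval t) = t.
Proof. by apply: val_inj; exact/clampE/uval_itv. Qed.

Lemma clamp_continuous : continuous clamp.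
Proof.
apply: (@continuous_comp_initial _ _ _ set_val) => x.
have cmin : {for x, continuous (id \min cst 1 : R -> R^o)}.
  apply: continuous_min; last exact: cvg_cst.
  exact: (@cvg_id _ (nbhs x)).
exact: (@continuous_max R R (cst 0) _ x (cvg_cst _) cmin).
Qed.

Lemma uval_continuous : continuous uval.
Proof. exact: initial_continuous. Qed.

Lemma unit_interval_subproof : clamp 0 != clamp 1.
Proof.
apply/eqP => /(congr1 uval); rewrite !clampE ?lexx ?ler01// => /eqP.
by rewrite eq_sym oner_eq0.
Qed.

HB.instance Definition _ :=
  isBiPointed.Build unit_interval unit_interval_subproof.

Lemma clamp_le0 (x : R) : x <= 0 -> clamp x = zero.
Proof.
move=> x0; apply: val_inj; rewrite /= /clamp_fun (min_l ler01) maxxx max_l//.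
by rewrite ge_min x0.
Qed.

Lemma clamp_ge1 (x : R) : 1 <= x -> clamp x = one.
Proof. by move=> x1; apply: val_inj; rewrite /= /clamp_fun minxx min_r. Qed.

End unit_interval.
Arguments unit_interval : clear implicits.
Arguments uval {R} t : simpl never.

Section clamp_continuity.
Context {R : realType} {S : topologicalType}.

Lemma clamp_comp_continuous (f : S -> R) :
  continuous f -> continuous (fun s => clamp (f s)).
Proof. by move=> cf s; apply: continuous_comp; [exact: cf|exact: clamp_continuous]. Qed.

Lemma uval_comp_continuous (f : S -> unit_interval R) :
  continuous f -> continuous (fun s => uval (f s) : R).
Proof.
by move=> cf s; apply: continuous_comp; [exact: cf|exact: uval_continuous].
Qed.

Lemma double_continuous (f : S -> R) :
  continuous f -> continuous (fun s => 2 * f s).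
Proof.
move=> cf s; exact: (@continuousM _ _ (fun=> 2) f s (cvg_cst _) (cf s)).
Qed.

Lemma sub1_continuous (f : S -> R) :
  continuous f -> continuous (fun s => f s - 1).
Proof.
by move=> cf s; apply: continuousB; [exact: cf|exact: cvg_cst].
Qed.

Lemma double_sub1_continuous (f : S -> R) :
  continuous f -> continuous (fun s => 2 * f s - 1).
Proof.
by move=> cf; exact: sub1_continuous (double_continuous cf).
Qed.

Lemma addc_continuous (c : R) (f : S -> R) :
  continuous f -> continuous (fun s => f s + c).
Proof.
by move=> cf s; apply: continuousD; [exact: cf|exact: cvg_cst].
Qed.

Lemma mulc_continuous (c : R) (f : S -> R) :
  continuous f -> continuous (fun s => f s * c).
Proof.
move=> cf s; exact: (@continuousM _ _ f (fun=> c) s (cf s) (cvg_cst _)).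
Qed.

Lemma onem_continuous (f : S -> R) :
  continuous f -> continuous (fun s => 1 - f s).
Proof.
by move=> cf s; apply: continuousB; [exact: cvg_cst|exact: cf].
Qed.

Lemma min_continuous (f g : S -> R) :
  continuous f -> continuous g -> continuous (fun s => Num.min (f s) (g s)).
Proof. by move=> cf cg s; exact: (@continuous_min R S f g s (cf s) (cg s)). Qed.

End clamp_continuity.

Section path_operations.
Context {R : realType} {T : topologicalType}.
Local Notation I := (unit_interval R).

Lemma path_continuous (x y : T) (p : {path I from x to y in T}) : continuous p.
Proof. exact: cts_fun. Qed.

Lemma path_comp_continuous (S : topologicalType) (x y : T)
    (p : {path I from x to y in T}) (f : S -> I) :
  continuous f -> continuous (fun s => p (f s)).
Proof.
move=> cf s; apply: (@continuous_comp _ _ _ f p); first exact: cf.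
exact: path_continuous.
Qed.

Lemma uval_zero : uval (zero : I) = 0 :> R.
Proof. by rewrite clampE// lexx ler01. Qed.

Lemma uval_one : uval (one : I) = 1 :> R.
Proof. by rewrite clampE// lexx ler01. Qed.

Section concatenation.
Context {x y z : T}.
Variables (p : {path I from x to y in T}) (q : {path I from y to z in T}).

Definition concat_fun (t : I) : T :=
  if uval t <= 2^-1 then p (clamp (2 * uval t)) else q (clamp (2 * uval t - 1)).

Lemma concat_le t : uval t <= 2^-1 -> concat_fun t = p (clamp (2 * uval t)).
Proof. by rewrite /concat_fun => ->. Qed.

Lemma concat_ge t : 2^-1 <= uval t -> concat_fun t = q (clamp (2 * uval t - 1)).
Proof.
rewrite /concat_fun le_eqVlt => /predU1P[<-|]; last by move=> h; rewrite leNgt h.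
by rewrite lexx mulfV// subrr path_one path_zero.
Qed.

Lemma concat_continuous : continuous concat_fun.
Proof.
apply: (@pasting _ _ _ (fun t : I => uval t) 2^-1
  (fun t => p (clamp (2 * uval t))) (fun t => q (clamp (2 * uval t - 1)))).
- exact: uval_continuous.
- apply: path_comp_continuous; apply: clamp_comp_continuous.
  by apply: double_continuous; exact: uval_continuous.
- apply: path_comp_continuous; apply: clamp_comp_continuous.
  by apply: double_sub1_continuous; exact: uval_continuous.
- by move=> t ->; rewrite mulfV// subrr path_one path_zero.
Qed.

Lemma concat_zero : concat_fun zero = x.
Proof.
by rewrite concat_le uval_zero ?invr_ge0// mulr0 path_zero.
Qed.

Lemma concat_one : concat_fun one = z.
Proof.
rewrite concat_ge uval_one; last lra.
by rewrite (_ : 2 * 1 - 1 = 1) ?path_one//; ring.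
Qed.

Definition concat : {path I from x to z in T} :=
  mk_path concat_continuous concat_zero concat_one.

End concatenation.

Section reversal.
Context {x y : T}.
Variable p : {path I from x to y in T}.

Definition rev_fun (t : I) : T := p (clamp (1 - uval t)).

Lemma rev_continuous : continuous rev_fun.
Proof.
apply: path_comp_continuous; apply: clamp_comp_continuous.
by apply: onem_continuous; exact: uval_continuous.
Qed.

Lemma rev_zero : rev_fun zero = y.
Proof. by rewrite /rev_fun uval_zero subr0 path_one. Qed.

Lemma rev_one : rev_fun one = x.
Proof. by rewrite /rev_fun uval_one subrr path_zero. Qed.

Definition rev_path : {path I from y to x in T} :=
  mk_path rev_continuous rev_zero rev_one.

Lemma rev_pathE t : rev_path t = p (clamp (1 - uval t)).
Proof. by []. Qed.

End reversal.

Definition homotopic (x y : T) (p q : {path I from x to y in T}) : Prop :=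
  exists H : I * I -> T, [/\ continuous H,
    forall t, H (t, zero) = p t, forall t, H (t, one) = q t,
    forall s, H (zero, s) = x & forall s, H (one, s) = y].

Section homotopy_theory.
Context {x y z : T}.
Implicit Types (p : {path I from x to y in T}) (q : {path I from y to z in T}).

Lemma homotopic_refl p : homotopic p p.
Proof.
exists (fun ts => p ts.1); split=> //; [|by move=> s; rewrite path_zero..|].
  by apply: path_comp_continuous => ts; exact: cvg_fst.
by move=> s; rewrite path_one.
Qed.

Lemma pairr_continuous (f g : I * I -> I) (H : I * I -> T) :
  continuous f -> continuous g -> continuous H ->
  continuous (fun ts => H (f ts, g ts)).
Proof.
move=> cf cg cH ts; apply: (@continuous_comp _ _ _ (fun ts => (f ts, g ts)) H).
  exact: (cvg_pair (cf ts) (cg ts)).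
exact: cH.
Qed.

Let fstI : continuous (fst : I * I -> I). Proof. by move=> ?; exact: cvg_fst. Qed.
Let sndI : continuous (snd : I * I -> I). Proof. by move=> ?; exact: cvg_snd. Qed.

Lemma homotopic_sym p p' : homotopic p p' -> homotopic p' p.
Proof.
move=> [H [cH H0 H1 Hx Hy]].
exists (fun ts => H (ts.1, clamp (1 - uval ts.2))); split=> [|t|t|s|s] /=.
- apply: pairr_continuous => //; apply: clamp_comp_continuous.
  by apply: onem_continuous; exact: uval_comp_continuous.
- by rewrite uval_zero subr0 H1.
- by rewrite uval_one subrr H0.
- exact: Hx.
- exact: Hy.
Qed.

Lemma homotopic_trans p p' p'' :
  homotopic p p' -> homotopic p' p'' -> homotopic p p''.
Proof.
move=> [H [cH H0 H1 Hx Hy]] [K [cK K0 K1 Kx Ky]].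
exists (fun ts => if uval ts.2 <= (2^-1 : R) then H (ts.1, clamp (2 * uval ts.2))
                  else K (ts.1, clamp (2 * uval ts.2 - 1))).
split=> [|t|t|s|s] /=.
- apply: (@pasting _ _ _ (fun ts : I * I => uval ts.2) 2^-1
    (fun ts => H (ts.1, clamp (2 * uval ts.2)))
    (fun ts => K (ts.1, clamp (2 * uval ts.2 - 1)))).
  + exact: uval_comp_continuous.
  + apply: pairr_continuous => //; apply: clamp_comp_continuous.
    by apply: double_continuous; exact: uval_comp_continuous.
  + apply: pairr_continuous => //; apply: clamp_comp_continuous.
    by apply: double_sub1_continuous; exact: uval_comp_continuous.
  + by move=> ts ->; rewrite mulfV// subrr H1 K0.
- by rewrite uval_zero invr_ge0 ler0n mulr0 H0.
- rewrite uval_one ifF; last by apply/negbTE; rewrite -ltNge; lra.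
  by rewrite (_ : 2 * 1 - 1 = 1) ?K1//; ring.
- by case: ifP => _; [exact: Hx|exact: Kx].
- by case: ifP => _; [exact: Hy|exact: Ky].
Qed.

Lemma homotopic_concat p p' q q' :
  homotopic p p' -> homotopic q q' -> homotopic (concat p q) (concat p' q').
Proof.
move=> [H [cH H0 H1 Hx Hy]] [K [cK K0 K1 Ky Kz]].
exists (fun ts => if uval ts.1 <= (2^-1 : R) then H (clamp (2 * uval ts.1), ts.2)
                  else K (clamp (2 * uval ts.1 - 1), ts.2)).
split=> [|t|t|s|s] /=.
- apply: (@pasting _ _ _ (fun ts : I * I => uval ts.1) 2^-1
    (fun ts => H (clamp (2 * uval ts.1), ts.2))
    (fun ts => K (clamp (2 * uval ts.1 - 1), ts.2))).
  + exact: uval_comp_continuous.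
  + apply: pairr_continuous => //; apply: clamp_comp_continuous.
    by apply: double_continuous; exact: uval_comp_continuous.
  + apply: pairr_continuous => //; apply: clamp_comp_continuous.
    by apply: double_sub1_continuous; exact: uval_comp_continuous.
  + by move=> ts ->; rewrite mulfV// subrr Hy Ky.
- by rewrite H0 K0.
- by rewrite H1 K1.
- by rewrite uval_zero invr_ge0 ler0n mulr0 Hx.
- rewrite uval_one ifF; last by apply/negbTE; rewrite -ltNge; lra.
  by rewrite (_ : 2 * 1 - 1 = 1) ?Kz//; ring.
Qed.

Lemma homotopic_rev p p' : homotopic p p' -> homotopic (rev_path p) (rev_path p').
Proof.
move=> [H [cH H0 H1 Hx Hy]].
exists (fun ts => H (clamp (1 - uval ts.1), ts.2)); split=> [|t|t|s|s] /=.
- apply: pairr_continuous => //; apply: clamp_comp_continuous.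
  by apply: onem_continuous; exact: uval_comp_continuous.
- by rewrite H0.
- by rewrite H1.
- by rewrite uval_zero subr0 Hy.
- by rewrite uval_one subrr Hx.
Qed.

Lemma homotopic_reparam (a b : T) (p : {path I from x to y in T})
    (f g : {path I from a to b in T}) (phi psi : I -> I) :
  continuous phi -> continuous psi ->
  phi zero = psi zero -> phi one = psi one ->
  (forall t, f t = p (phi t)) -> (forall t, g t = p (psi t)) -> homotopic f g.
Proof.
move=> cphi cpsi e0 e1 fE gE.
exists (fun ts => p (clamp ((1 - uval ts.2) * uval (phi ts.1)
                            + uval ts.2 * uval (psi ts.1)))).
split=> [|t|t|s|s].
- apply: path_comp_continuous; apply: clamp_comp_continuous => ts.
  have c1 (h : I -> I) : continuous h -> continuous (fun ts : I * I => h ts.1).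
    move=> ch u; apply: (@continuous_comp _ _ _ fst h); first exact: cvg_fst.
    exact: ch.
  have cs : continuous (fun ts : I * I => uval ts.2) := uval_comp_continuous sndI.
  apply: cvgD.
    apply: cvgM; [exact: onem_continuous cs ts|].
    exact: uval_comp_continuous (c1 _ cphi) ts.
  apply: cvgM; [exact: cs|exact: uval_comp_continuous (c1 _ cpsi) ts].
- by rewrite [snd _]/= uval_zero subr0 mul1r mul0r addr0 clampK fE.
- by rewrite [snd _]/= uval_one subrr mul1r mul0r add0r clampK gE.
- rewrite [fst _]/= e0 -mulrDl subrK mul1r clampK -gE; exact: path_zero.
- rewrite [fst _]/= e1 -mulrDl subrK mul1r clampK -gE; exact: path_one.
Qed.

End homotopy_theory.
End path_operations.

Section homotopy_laws.
Context {R : realType} {T : topologicalType} {x y z w : T}.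
Local Notation I := (unit_interval R).
Implicit Types (p : {path I from x to y in T}) (q : {path I from y to z in T})
  (r : {path I from z to w in T}).

Definition cst_path (a : T) : {path I from a to a in T} := cst a.

Let idI : continuous (id : I -> I). Proof. by move=> t; exact: cvg_id. Qed.

Let uI : continuous (uval : I -> R). Proof. exact: uval_continuous. Qed.

Lemma concat1p p : homotopic (concat (cst_path x) p) p.
Proof.
apply: (homotopic_reparam (p := p) (psi := id)
  (phi := fun t => clamp (2 * uval t - 1))) => //.
- exact/clamp_comp_continuous/double_sub1_continuous.
- by rewrite uval_zero clamp_le0//; lra.
- by rewrite uval_one clamp_ge1//; lra.
move=> t; have [t2|t2] := leP (uval t) 2^-1.
  by rewrite [LHS]concat_le// [in RHS]clamp_le0 ?path_zero//; lra.
by rewrite [LHS]concat_ge// ltW.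
Qed.

Lemma concatp1 p : homotopic (concat p (cst_path y)) p.
Proof.
apply: (homotopic_reparam (p := p) (psi := id)
  (phi := fun t => clamp (2 * uval t))) => //.
- exact/clamp_comp_continuous/double_continuous.
- by rewrite uval_zero clamp_le0//; lra.
- by rewrite uval_one clamp_ge1//; lra.
move=> t; have [t2|t2] := leP (uval t) 2^-1.
  by rewrite [LHS]concat_le.
by rewrite [LHS]concat_ge ?ltW// [in RHS]clamp_ge1 ?path_one//; lra.
Qed.

Lemma concatVp p : homotopic (concat (rev_path p) p) (cst_path y).
Proof.
apply: (homotopic_reparam (p := p) (psi := cst one)
  (phi := fun t => clamp `|2 * uval t - 1|)) => //.
- apply: clamp_comp_continuous => t.
  apply: (@continuous_comp _ _ _ (fun t : I => 2 * uval t - 1) Num.norm).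
    exact: double_sub1_continuous.
  exact: norm_continuous.
- exact: cst_continuous.
- by rewrite uval_zero mulr0 sub0r normrN1.
- by rewrite uval_one (_ : 2 * 1 - 1 = 1) ?normr1//; ring.
- move=> t; have /andP[t0 t1] := uval_itv t.
  have [t2|t2] := leP (uval t) 2^-1.
    rewrite [LHS]concat_le// rev_pathE clampE; last by apply/andP; split; lra.
    by rewrite ler0_norm ?opprB//; lra.
  by rewrite [LHS]concat_ge ?ltW// ger0_norm//; lra.
- by move=> t; rewrite path_one.
Qed.

Lemma rev_pathK p : rev_path (rev_path p) = p.
Proof.
apply/path_eqP => t; have /andP[t0 t1] := uval_itv t.
rewrite !rev_pathE clampE; last by apply/andP; split; lra.
by rewrite subKr clampK.
Qed.

Lemma concatA p q r :
  homotopic (concat p (concat q r)) (concat (concat p q) r).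
Proof.
apply/homotopic_sym; apply: (homotopic_reparam (p := concat p (concat q r))
  (psi := id) (phi := fun t => clamp (Num.min (2 * uval t)
     (Num.min (uval t + 4^-1) ((uval t + 1) / 2))))) => //.
- apply: clamp_comp_continuous; apply: min_continuous.
    exact: double_continuous.
  apply: min_continuous; first exact: addc_continuous.
  exact: (mulc_continuous (addc_continuous uI)).
- by rewrite uval_zero clamp_le0// ge_min; apply/orP; left; lra.
- by rewrite uval_one clamp_ge1// !le_min; apply/and3P; split; lra.
move=> t; have /andP[t0 t1] := uval_itv t.
have in01 (a : R) : 0 <= a -> a <= 1 -> 0 <= a <= 1 by move=> -> ->.
have [t2|/ltW t2] := leP (uval t) 2^-1.
  rewrite [LHS]concat_le//.
  have u2 : uval (clamp (2 * uval t)) = 2 * uval t by rewrite clampE// in01; lra.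
  have [t4|/ltW t4] := leP (uval t) 4^-1.
    rewrite [LHS]concat_le ?u2; last lra.
    rewrite min_l; last by rewrite le_min; apply/andP; split; lra.
    by rewrite [RHS]concat_le u2//; lra.
  rewrite [LHS]concat_ge ?u2; last lra.
  rewrite (min_l (_ : uval t + 4^-1 <= _)); last lra.
  rewrite min_r; last lra.
  have v : uval (clamp (uval t + 4^-1)) = uval t + 4^-1 by rewrite clampE// in01; lra.
  rewrite [RHS]concat_ge v; last lra.
  have v' : uval (clamp (2 * (uval t + 4^-1) - 1)) = 2 * (uval t + 4^-1) - 1.
    by rewrite clampE// in01; lra.
  rewrite [RHS]concat_le v'; last lra.
  by congr (q (clamp _)); lra.
rewrite [LHS]concat_ge//.
rewrite (min_r (_ : _ <= uval t + 4^-1)); last lra.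
rewrite min_r; last lra.
have v : uval (clamp ((uval t + 1) / 2)) = (uval t + 1) / 2 by rewrite clampE// in01; lra.
rewrite [RHS]concat_ge v; last lra.
have v' : uval (clamp (2 * ((uval t + 1) / 2) - 1)) = 2 * ((uval t + 1) / 2) - 1.
  by rewrite clampE// in01; lra.
rewrite [RHS]concat_ge v'; last lra.
by congr (r (clamp _)); lra.
Qed.

End homotopy_laws.

Section fundamental_group.
Context {R : realType} (T : topologicalType) (x0 : T).

Definition loop := {path unit_interval R from x0 to x0 in T}.

HB.instance Definition _ := Choice.on loop.

Definition loop_homotopic (p q : loop) : bool := `[< homotopic p q >].

Lemma loop_homotopic_equiv : equiv_class_of loop_homotopic.
Proof.
split=> [p|p q|q p r].
- exact/asboolP/homotopic_refl.
- by apply/asboolP/asboolP => /homotopic_sym.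
- move=> /asboolP pq /asboolP qr; exact/asboolP/(homotopic_trans pq).
Qed.

Canonical loop_homotopic_equiv_rel := EquivRelPack loop_homotopic_equiv.

Definition fundamental_group := {eq_quot loop_homotopic}.

HB.instance Definition _ := Choice.on fundamental_group.
HB.instance Definition _ := EqQuotient.on fundamental_group.

Lemma pi_homotopic (p q : loop) :
  \pi_fundamental_group p = \pi_fundamental_group q <-> homotopic p q.
Proof. by split => [/eqmodP/asboolP|h] //; apply/eqmodP/asboolP. Qed.

Lemma repr_homotopic (p : loop) : homotopic (repr (\pi_fundamental_group p)) p.
Proof. by apply/pi_homotopic; rewrite reprK. Qed.

Definition fg_one : fundamental_group := \pi_fundamental_group (cst_path x0 : loop).

Definition fg_mul (a b : fundamental_group) : fundamental_group :=
  \pi_fundamental_group (concat (repr a) (repr b) : loop).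

Definition fg_inv (a : fundamental_group) : fundamental_group :=
  \pi_fundamental_group (rev_path (repr a) : loop).

Lemma fg_mulE (p q : loop) :
  fg_mul (\pi_fundamental_group p) (\pi_fundamental_group q) = \pi_fundamental_group (concat p q : loop).
Proof. by apply/pi_homotopic/homotopic_concat; exact: repr_homotopic. Qed.

Lemma fg_invE (p : loop) : fg_inv (\pi_fundamental_group p) = \pi_fundamental_group (rev_path p : loop).
Proof. by apply/pi_homotopic/homotopic_rev; exact: repr_homotopic. Qed.

Lemma fg_mulA : associative fg_mul.
Proof.
move=> a b c; rewrite -[a]reprK -[b]reprK -[c]reprK.
set p := repr a; set q := repr b; set r := repr c.
rewrite (fg_mulE q r) (fg_mulE p q) (fg_mulE p (concat q r)).
by rewrite (fg_mulE (concat p q) r); exact/pi_homotopic/concatA.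
Qed.

Lemma fg_mul1g : left_id fg_one fg_mul.
Proof. by move=> a; rewrite -[a]reprK fg_mulE; exact/pi_homotopic/concat1p. Qed.

Lemma fg_mulg1 : right_id fg_one fg_mul.
Proof. by move=> a; rewrite -[a]reprK fg_mulE; exact/pi_homotopic/concatp1. Qed.

Lemma fg_mulVg : left_inverse fg_one fg_inv fg_mul.
Proof.
by move=> a; rewrite -[a]reprK fg_invE fg_mulE; exact/pi_homotopic/concatVp.
Qed.

Lemma fg_mulgV : right_inverse fg_one fg_inv fg_mul.
Proof.
move=> a; rewrite -[a]reprK fg_invE fg_mulE; apply/pi_homotopic.
by rewrite -{1}[repr a]rev_pathK; exact: concatVp.
Qed.

HB.instance Definition _ := isGroup.Build fundamental_group
  fg_mulA fg_mul1g fg_mulg1 fg_mulVg fg_mulgV.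

End fundamental_group.
Arguments fundamental_group : clear implicits.

Lemma tt_eq (x : unit) : tt = x. Proof. by case: x. Qed.

HB.instance Definition _ := @isGroup.Build unit tt (fun _ => tt) (fun _ _ => tt)
  (fun _ _ _ => erefl) tt_eq tt_eq
  (fun _ => erefl) (fun _ => erefl).

Definition group_isomorphic (G H : groupType) : Prop :=
  exists f : {multiplicative G -> H}, bijective f.

(* Without a base point, the fundamental group of a nonempty space is G if it
   is isomorphic to G at every base point. *)
Definition has_fundamental_group (R : realType) (T : topologicalType)
    (G : groupType) : Prop :=
  [set: T] !=set0 /\
  forall x0 : T, group_isomorphic (fundamental_group R T x0) G.

(* The Euclidean topology on C is the one given by the modulus. *)
HB.instance Definition _ (R : realType) :=
  NormedModule.copy R[i] (R[i] : numClosedFieldType).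

Section tensors.
Context {R : realType} {d : nat} (W : 'I_d -> vectType R[i]).
Local Notation C := R[i].

Definition multi_index : finType := {dffun forall j : 'I_d, 'I_(\dim {: W j})}.

(* The tensor product of the W j, in coordinates with respect to the products
   of basis vectors; `tensor_universal` below is its universal property. *)
Definition tensor : Type := {ptws multi_index -> C}.

HB.instance Definition _ := GRing.Lmodule.on tensor.
HB.instance Definition _ := Topological.on tensor.

Definition tprod (v : forall j, W j) : tensor :=
  fun m => \prod_j coord (vbasis {: W j}) (m j) (v j).

Definition multilinear (U : lmodType C) (g : (forall j, W j) -> U) : Prop :=
  forall (v : forall j, W j) (j : 'I_d) (a : C) (x y : W j),
    g (dfwith v j (a *: x + y)) = a *: g (dfwith v j x) + g (dfwith v j y).

Definition basis_vectors (m : multi_index) (j : 'I_d) : W j :=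
  (vbasis {: W j})`_(m j).

Lemma tprod_multilinear : multilinear tprod.
Proof.
move=> v j a x y; apply/funext => m.
have E (z : W j) : tprod (dfwith v j z) m =
    coord (vbasis {: W j}) (m j) z *
      \prod_(k | k != j) coord (vbasis {: W k}) (m k) (v k).
  rewrite /tprod (bigD1 j)//= dfwithin; congr (_ * _).
  by apply: eq_bigr => k kj; rewrite dfwithout// eq_sym.
rewrite [RHS](_ : _ = a * tprod (dfwith v j x) m + tprod (dfwith v j y) m)//.
by rewrite !E linearP/= mulrDl mulrA.
Qed.

Lemma tprod_basis (m m' : multi_index) :
  tprod (basis_vectors m) m' = (m' == m)%:R.
Proof.
rewrite /tprod; have [->|mm'] := eqVneq m' m.
  rewrite big1// => j _; rewrite coord_free ?eqxx//.
  exact: basis_free (vbasisP _).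
have [j mj] : exists j, m' j != m j.
  apply/existsP; rewrite -negb_forall; apply: contra mm' => /forallP h.
  by apply/eqP/ffunP => j; exact/eqP/h.
rewrite (bigD1 j)//= coord_free ?(negbTE mj) ?mul0r//.
  by rewrite eq_sym (negbTE mj) mul0r.
exact: basis_free (vbasisP _).
Qed.

Lemma multilinear_sum (U : lmodType C) (g : (forall j, W j) -> U) v (j : 'I_d)
    (I : Type) (s : seq I) (c : I -> C) (e : I -> W j) :
  multilinear g ->
  g (dfwith v j (\sum_(k <- s) c k *: e k)) =
    \sum_(k <- s) c k *: g (dfwith v j (e k)).
Proof.
move=> gl; elim: s => [|k s IH]; last by rewrite !big_cons gl IH.
by rewrite !big_nil -[in LHS](addNr 0) -scaleN1r gl scaleN1r addNr.
Qed.

Lemma multilinear_eq (U : lmodType C) (g h : (forall j, W j) -> U) :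
  multilinear g -> multilinear h ->
  (forall m, g (basis_vectors m) = h (basis_vectors m)) -> g =1 h.
Proof.
move=> gl hl gh.
suff P (s : seq 'I_d) v : (forall j, j \notin s ->
    exists k : 'I_(\dim {: W j}), v j = (vbasis {: W j})`_k) -> g v = h v.
  by move=> v; apply: (P (enum 'I_d)) => j; rewrite mem_enum.
elim: s v => [|j s IH] v vs.
  have {}vs j : {k : 'I_(\dim {: W j}) | v j = (vbasis {: W j})`_k}.
    exact/cid/vs.
  have -> : v = basis_vectors [ffun j => sval (vs j)] :> (forall j, W j).
    apply: functional_extensionality_dep => j.
    by rewrite /basis_vectors ffunE; case: (vs j).
  exact: gh.
have -> : v = dfwith v j (\sum_k coord (vbasis {: W j}) k (v j) *:
                            (vbasis {: W j})`_k).
  rewrite -coord_vbasis ?memvf//; apply: functional_extensionality_dep => k.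
  by have [<-|jk] := eqVneq j k; rewrite ?dfwithin ?dfwithout.
rewrite !multilinear_sum//; apply: eq_bigr => k _; congr (_ *: _).
apply: IH => l ls; have [<-|jl] := eqVneq j l.
  by exists k; rewrite dfwithin.
rewrite dfwithout//; apply: vs.
by rewrite inE negb_or ls andbT eq_sym.
Qed.

Lemma tensor_basis (A : tensor) : A = \sum_m A m *: tprod (basis_vectors m).
Proof.
apply/funext => m'; rewrite fct_sumE (bigD1 m')//= big1 ?addr0.
  by rewrite [RHS](_ : _ = A m' * tprod (basis_vectors m') m')// tprod_basis eqxx mulr1.
move=> m mm'.
rewrite [LHS](_ : _ = A m * tprod (basis_vectors m) m')// tprod_basis eq_sym.
by rewrite (negbTE mm') mulr0.
Qed.

Theorem tensor_universal (U : lmodType C) (g : (forall j, W j) -> U) :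
  multilinear g ->
  exists h : {linear tensor -> U}, (forall v, h (tprod v) = g v) /\
    forall k : {linear tensor -> U}, (forall v, k (tprod v) = g v) -> k =1 h.
Proof.
move=> gl; pose h (A : tensor) : U := \sum_m A m *: g (basis_vectors m).
have hl : linear h.
  move=> a A B; rewrite /h scaler_sumr -big_split; apply: eq_bigr => m _.
  rewrite (_ : (a *: A + B) m = a * A m + B m)//.
  by rewrite scalerDl scalerA.
pose h' : {linear tensor -> U} := HB.pack h (GRing.isLinear.Build _ _ _ _ h hl).
exists h'; split.
  apply: multilinear_eq => //.
    by move=> v j a x y; rewrite tprod_multilinear linearP.
  move=> m; rewrite /h' /= /h (bigD1 m)//= tprod_basis eqxx scale1r big1 ?addr0//.
  by move=> m' mm'; rewrite tprod_basis (negbTE mm') scale0r.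
move=> k kE A; rewrite [A in LHS]tensor_basis linear_sum; apply: eq_bigr => m _.
by rewrite linearZ kE.
Qed.

Definition sum_of_tprods (r : nat) (A : tensor) : Prop :=
  exists v : 'I_r -> forall j, W j, A = \sum_(k < r) tprod (v k).

Definition has_rank (A : tensor) (r : nat) : Prop :=
  sum_of_tprods r A /\ forall s, sum_of_tprods s A -> (r <= s)%N.

Definition rank_decomposition (A : tensor) (r : nat) (D : set tensor) : Prop :=
  exists x : 'I_r -> tensor,
    [/\ forall k, has_rank (x k) 1, A = \sum_(k < r) x k & D = range x].

(* The summands of a decomposition of length rank A are pairwise distinct, so
   that the set of summands determines the decomposition up to reordering. *)
Definition identifiable (A : tensor) : Prop :=
  exists2 r, has_rank A r & exists! D, rank_decomposition A r D.

End tensors.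

(* Main.v *)
(** Rank-one tensors are the products of tuples u = (u_1, ..., u_d) of nonzero
    vectors, and identifiable tensors of rank two are the sums of the products of
    two such tuples u, v for which u_j and v_j are independent for at least three
    indices j. The pairs (u, v) to be avoided form a set of complex codimension at
    least two. A loop of admissible pairs is first deformed into one that moves a
    single coordinate at a time; it then runs through finitely many complex lines,
    so a generic p gives straight segments from (u, v) to (u, p) that stay
    admissible, and likewise from (u, p) to (q, p). Hence admissible loops are
    contractible.

    A loop of rank-one tensors lifts to a loop of tuples, which gives (i). For
    (ii), the two components of a tensor A of rank two depend continuously on A:
    contracting A along one index with F - mu G leaves a 2x2 matrix which is
    singular exactly when F - mu G kills one of the two vectors at that index, and
    the components are rational functions of A and of the two values of mu. So the
    components form a double cover; loops with trivial monodromy are contractible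
    by the above, and a path from (u, v) to (v, u) exchanges the two sheets. *)

Require Import Defs.
From HB Require Import structures.
From mathcomp Require Import all_boot all_order all_algebra.
From mathcomp Require Import complex.
From mathcomp Require Import all_classical all_reals all_analysis homotopy.
From mathcomp Require Import ring lra.

Set Implicit Arguments.
Unset Strict Implicit.
Unset Printing Implicit Defensive.

Import Order.TTheory GRing.Theory Num.Theory numFieldNormedType.Exports.

Local Open Scope classical_set_scope.
Local Open Scope ring_scope.
Local Open Scope complex_scope.

(** The obstacle is that a merely continuous loop may sweep out a large set, so a dimension count
    gives no apex from which its cone avoids the bad pairs. On a piece of the staircase all
    coordinates but one are frozen at values of the loop at multiples of 1/n. A functional ignoring
    the moving coordinate is then constant along the piece, so each piece imposes finitely many
    conditions on the apex, and there are finitely many pieces. Segments have a real parameter,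
    hence each condition only forbids a functional of the apex to lie on at most a real line in C,
    and finitely many such conditions can be met together. The numerical hypothesis of (ii) excludes
    exactly d = 3 with n_1 = 2; it provides, outside any two factors, one with two coordinates
    besides the moving one, which is where such functionals come from.

    For the components, the quadratic equation for mu is never solved: near the centre of an adapted
    frame one root is close to 0 and the other to infinity, and bounds on the first and on the
    inverse of the second replace a choice of square roots. *)

Section interval_induction.
Context {R : realType}.

(** Compactness of [0, 1] as real induction, through the supremum of the [x] with [P 0 x]. It serves
    to glue local lifts and to make local radii uniform. *)
Lemma interval_ind (P : R -> R -> Prop) :
  (forall x, 0 <= x <= 1 -> exists2 e, 0 < e &
    forall a b, 0 <= a -> a <= b -> b <= 1 -> x - e < a -> b < x + e -> P a b) ->
  (forall a b c, a <= b -> b <= c -> P a b -> P b c -> P a c) ->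
  P 0 1.
Proof.
move=> loc glue.
pose S := [set x : R | 0 <= x <= 1 /\ P 0 x].
have S0 : S 0.
  split; first by rewrite lexx ler01.
  have [|e e0 h] := loc 0; first by rewrite lexx ler01.
  by apply: h; lra.
have Sub : has_ubound S by exists 1 => x [/andP[]].
have Ssup : has_sup S by split; [exists 0|].
have s01 : 0 <= sup S <= 1.
  apply/andP; split; first exact: ub_le_sup.
  by apply: ge_sup; [exists 0|move=> x [/andP[]]].
have [e e0 h] := loc _ s01.
have [x [/andP[x0 x1] Px] xs] := sup_adherent e0 Ssup.
have xle : x <= sup S by apply: ub_le_sup => //; split=> //; apply/andP.
(* Half of [e] beyond the supremum, cut off at 1. As [y] turns out to lie in [S], the cut-off must
   have been effective, so [y] is 1. *)
pose y := Num.min (sup S + e / 2) 1.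
have y1 : y <= 1 by rewrite /y ge_min lexx orbT.
have ye : y <= sup S + e / 2 by rewrite /y ge_min lexx.
have xy : x <= y by rewrite /y le_min x1 andbT; lra.
have Py : P 0 y by apply: (glue _ x) => //; apply: h => //; lra.
have yS : y <= sup S by apply: ub_le_sup => //; split=> //; apply/andP; split => //; lra.
suff -> : 1 = y by [].
rewrite /y in yS *; case: (leP (sup S + e / 2) 1) yS => //.
lra.
Qed.

End interval_induction.

(** * Continuity of complex-valued functions and of tensors *)

Section numfield_continuity.
Variables (K : numFieldType) (S : topologicalType).

Lemma numfield_contD (f g : S -> K) s :
  {for s, continuous f} -> {for s, continuous g} -> {for s, continuous (fun x => f x + g x)}.
Proof. by move=> cf cg; exact: cvgD. Qed.

Lemma numfield_contM (f g : S -> K) s :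
  {for s, continuous f} -> {for s, continuous g} -> {for s, continuous (fun x => f x * g x)}.
Proof. by move=> cf cg; exact: cvgM. Qed.

Lemma numfield_contN (f : S -> K) s :
  {for s, continuous f} -> {for s, continuous (fun x => - f x)}.
Proof. by move=> cf; exact: cvgN. Qed.

Lemma numfield_contV (f : S -> K) s :
  f s != 0 -> {for s, continuous f} -> {for s, continuous (fun x => (f x)^-1)}.
Proof. by move=> cf f0; exact: cvgV. Qed.

Lemma numfield_cont_neq0 (f : S -> K) s :
  f s != 0 -> {for s, continuous f} -> \forall x \near s, f x != 0.
Proof.
rewrite -normr_gt0 => f0 /cvgrPdist_lt/(_ _ f0); apply: filterS => x /=.
by apply: contraTneq => ->; rewrite subr0 ltxx.
Qed.

End numfield_continuity.

Section complex_continuity.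
Context {R : realType}.
Local Notation C := R[i].

(* An inductive wrapper: unification never unfolds it to compare the topology
   and the algebraic structures of C. *)
Variant ccont (S : topologicalType) (s : S) (f : S -> C) : Prop :=
  Ccont of @continuous_at S (C : topologicalType) s f.

Lemma ccontP (S : topologicalType) (s : S) (f : S -> C) :
  ccont s f <-> @continuous_at S (C : topologicalType) s f.
Proof. by split=> [[]|h]; [|constructor]. Qed.

Lemma ccont_real (S : topologicalType) (f : S -> R) (s : S) :
  {for s, continuous f} -> ccont s (fun x => (f x)%:C).
Proof.
move=> cf; apply/ccontP/(@cvgrPdist_lt (R[i] : numFieldType) (R[i] : normedModType R[i])) => e e0.
(* In the order of C a positive element is real, so the real estimate at the real part of [e] is all
   that is needed. *)
have eR : 0 < complex.Re e by move: e0; rewrite ltcE => /andP[].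
have := cf; move/cvgrPdist_lt => /(_ _ eR); apply: filterS => x hx.
move: e0; rewrite ltcE => /andP[/= /eqP e1 _].
by rewrite -rmorphB /= normc_def /= expr0n addr0 sqrtr_sqr ltcE /= -e1 eqxx /=.
Qed.

Lemma ccontD (S : topologicalType) (f g : S -> C) (s : S) :
  ccont s f -> ccont s g -> ccont s (fun x => f x + g x).
Proof. by move=> [cf] [cg]; constructor; exact (@numfield_contD (R[i] : numFieldType) S f g s cf cg). Qed.

Lemma ccontM (S : topologicalType) (f g : S -> C) (s : S) :
  ccont s f -> ccont s g -> ccont s (fun x => f x * g x).
Proof. by move=> [cf] [cg]; constructor; exact (@numfield_contM (R[i] : numFieldType) S f g s cf cg). Qed.

Lemma ccontN (S : topologicalType) (f : S -> C) (s : S) :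
  ccont s f -> ccont s (fun x => - f x).
Proof. by move=> [cf]; constructor; exact (@numfield_contN (R[i] : numFieldType) S f s cf). Qed.

Lemma ccontV (S : topologicalType) (f : S -> C) (s : S) :
  f s != 0 -> ccont s f -> ccont s (fun x => (f x)^-1).
Proof. by move=> f0 [cf]; constructor; exact (@numfield_contV (R[i] : numFieldType) S f s f0 cf). Qed.

Lemma ccont_cst (S : topologicalType) (c : C) (s : S) : ccont s (fun=> c).
Proof. by constructor; exact: cvg_cst. Qed.

Lemma ccontB (S : topologicalType) (f g : S -> C) (s : S) :
  ccont s f -> ccont s g -> ccont s (fun x => f x - g x).
Proof. by move=> cf cg; exact: (ccontD cf (ccontN cg)). Qed.

Lemma ccont_prod (S : topologicalType) (I : finType) (f : I -> S -> C) (s : S) :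
  (forall i, ccont s (f i)) -> ccont s (fun x => \prod_i f i x).
Proof.
move=> cf; rewrite unlock; elim: (index_enum I) => [|i r IH] /=; first exact: ccont_cst.
exact: (ccontM (cf i) IH).
Qed.

Lemma ccont_sum (S : topologicalType) (I : finType) (f : I -> S -> C) (s : S) :
  (forall i, ccont s (f i)) -> ccont s (fun x => \sum_i f i x).
Proof.
move=> cf; rewrite unlock; elim: (index_enum I) => [|i r IH] /=; first exact: ccont_cst.
exact: (ccontD (cf i) IH).
Qed.

Lemma ccont_comp (S T : topologicalType) (f : S -> T) (g : T -> C) (s : S) :
  {for s, continuous f} -> ccont (f s) g -> ccont s (fun x => g (f x)).
Proof. by move=> cf [cg]; constructor; exact: (@continuous_comp _ _ _ f g). Qed.

Lemma ccont_fst (S T : topologicalType) (f : S -> C) (z : S * T) :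
  ccont z.1 f -> ccont z (fun z => f z.1).
Proof. by move=> [cf]; constructor; exact: (@continuous_comp _ _ _ fst f z cvg_fst cf). Qed.

Lemma ccont_snd (S T : topologicalType) (f : T -> C) (z : S * T) :
  ccont z.2 f -> ccont z (fun z => f z.2).
Proof. by move=> [cf]; constructor; exact: (@continuous_comp _ _ _ snd f z cvg_snd cf). Qed.

Lemma ccont_neq0 (S : topologicalType) (f : S -> C) (s : S) :
  ccont s f -> f s != 0 -> \forall x \near s, f x != 0.
Proof.
by move=> [cf] f0; exact (@numfield_cont_neq0 (R[i] : numFieldType) S f s f0 cf).
Qed.

Lemma ccont_near_eq (S : topologicalType) (f g : S -> C) (s : S) :
  (\forall x \near s, f x = g x) -> ccont s f -> ccont s g.
Proof.
move=> fg [cf]; constructor; rewrite /continuous_at -(nbhs_singleton fg).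
exact: cvg_trans (near_eq_cvg fg) cf.
Qed.

End complex_continuity.

Section continuity_helpers.

Lemma cont_pair (S T U : topologicalType) (f : S -> T) (g : S -> U) :
  continuous f -> continuous g -> continuous (fun x => (f x, g x)).
Proof. by move=> cf cg s; exact: (cvg_pair (cf s) (cg s)). Qed.

Lemma cont_set_type (S T : topologicalType) (A : set T) (f : S -> set_type A) :
  continuous (fun s => set_val (f s)) -> continuous f.
Proof. by move=> cf; apply: (@continuous_comp_initial _ _ _ set_val). Qed.

Lemma cont_set_val (T : topologicalType) (A : set T) :
  continuous (set_val : set_type A -> T).
Proof. exact: initial_continuous. Qed.

End continuity_helpers.

Section tensor_continuity.
Context {R : realType} {d : nat} (W : 'I_d -> vectType R[i]).

(** The product topology is a supremum of initial topologies, so convergence may be tested on each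
    entry. *)
Lemma tensor_cvg (T : topologicalType) (F : set_system T) (FF : Filter F)  (f : T -> tensor W) (g : tensor W) :
  (forall m, (fun x => f x m) @ F --> g m) -> f @ F --> g.
Proof.
move=> h; apply/cvg_sup => m; apply/cvg_image.
  by rewrite eqEsubset; split=> // x _; exists (fun=> x).
apply: cvg_trans (h m) => V; rewrite nbhs_simpl => FV.
exists ((fun A : tensor W => A m) @^-1` V) => //.
by rewrite image_preimage // eqEsubset; split=> // j _; exists (fun _ => j).
Qed.

Lemma tensor_coord_cont (m : multi_index W) : continuous (fun A : tensor W => A m).
Proof. move=> A. exact: (@proj_continuous _ (fun=> R[i]) m). Qed.
End tensor_continuity.

(** * Homotopies and double covers *)

Section free_nullhomotopy.
Context {R : realType} {T : topologicalType} (x0 : T).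
Local Notation I := (unit_interval R).

(** Horizontal position and height of a point running around the square: it climbs during the first
    third of the time, crosses during the second and descends during the last. *)
Let mid (t : I) : I := clamp (3 * uval t - 1).
Let tent (t : I) : I := clamp (Num.min (3 * uval t) (3 * (1 - uval t))).

Let cont_scale (S : topologicalType) (c : R) (f : S -> R) :
  continuous f -> continuous (fun s => c * f s).
Proof.
move=> cf s; exact: (@continuousM _ _ (fun=> c) f s (cvg_cst _) (cf s)).
Qed.

Let uI : continuous (uval : I -> R). Proof. exact: uval_continuous. Qed.

Let mid_cont : continuous mid.
Proof. by apply: clamp_comp_continuous; apply: sub1_continuous; exact: cont_scale. Qed.

Let tent_cont : continuous tent.
Proof.
apply: clamp_comp_continuous; apply: Defs.min_continuous; first exact: cont_scale.
by apply: cont_scale; exact: onem_continuous.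
Qed.

Let mid0 : mid zero = zero. Proof. by rewrite /mid uval_zero clamp_le0//; lra. Qed.
Let mid1 : mid one = one. Proof. by rewrite /mid uval_one clamp_ge1//; lra. Qed.
Let tent0 : tent zero = zero.
Proof. by rewrite /tent uval_zero clamp_le0// ge_min mulr0 lexx. Qed.
Let tent1 : tent one = zero.
Proof. by rewrite /tent uval_one clamp_le0// ge_min subrr mulr0 lexx orbT. Qed.

(* The loop at height [s] climbs the left side of the square up to [s], crosses
   at height [s] and descends along the right side. *)
Lemma free_nullhomotopic (p : loop x0) (K : I * I -> T) (c : T) :
  continuous K -> (forall t, K (t, zero) = p t) -> (forall t, K (t, one) = c) ->
  (forall s, K (zero, s) = K (one, s)) -> homotopic p (cst_path x0).
Proof.
move=> cK K0 K1 Ks.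
have cfst (S : topologicalType) (f : I -> S) : continuous f ->
    continuous (fun ts : I * I => f ts.1).
  move=> cf ts; apply: (@continuous_comp _ _ _ fst f); first exact: cvg_fst.
  exact: cf.
have cu2 : continuous (fun ts : I * I => uval ts.2).
  by apply: uval_comp_continuous => ts; exact: cvg_snd.
have ctent : continuous (fun ts : I * I => uval (tent ts.1)).
  by apply: uval_comp_continuous; exact: cfst.
have cT : continuous (fun ts : I * I => uval ts.2 * uval (tent ts.1)).
  by move=> ts; apply: cvgM; [exact: cu2|exact: ctent].
have cT1 : continuous (fun ts : I * I => (1 - uval ts.2) * uval (tent ts.1)).
  by move=> ts; apply: cvgM; [exact: (onem_continuous cu2)|exact: ctent].
have cp1 : continuous (fun t => p (mid t)) by exact: path_comp_continuous.
have p10 : p (mid zero) = x0 by rewrite mid0 path_zero.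
have p11 : p (mid one) = x0 by rewrite mid1 path_one.
pose p1 : loop x0 := mk_path cp1 p10 p11.
have cp2 : continuous (fun t => K (mid t, tent t)).
  by move=> t; apply: (@continuous_comp _ _ _ (fun t => (mid t, tent t)) K);
     [exact: cont_pair|exact: cK].
have p20 : K (mid zero, tent zero) = x0 by rewrite mid0 tent0 K0 path_zero.
have p21 : K (mid one, tent one) = x0 by rewrite mid1 tent1 K0 path_one.
pose p2 : loop x0 := mk_path cp2 p20 p21.
apply: (@homotopic_trans _ _ _ _ _ p1).
  by apply: (homotopic_reparam (p := p) (phi := id) (psi := mid)) => //;
     move=> ?; exact: cvg_id.
apply: (@homotopic_trans _ _ _ _ _ p2).
  exists (fun ts => K (mid ts.1, clamp (uval ts.2 * uval (tent ts.1)))).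
  split=> [|t|t|s|s] /=.
  - move=> ts; apply: (@continuous_comp _ _ _
      (fun ts : I * I => (mid ts.1, clamp (uval ts.2 * uval (tent ts.1)))) K); last exact: cK.
    by apply: cont_pair; [exact: cfst|exact: clamp_comp_continuous].
  - by rewrite uval_zero mul0r clamp_le0// K0.
  - by rewrite uval_one mul1r clampK.
  - by rewrite mid0 tent0 uval_zero mulr0 clamp_le0// K0 path_zero.
  - by rewrite mid1 tent1 uval_zero mulr0 clamp_le0// K0 path_one.
(* On the middle third [p2] is the constant [c], and the two vertical sides of the square carry the
   same path. So [p2] runs along [K (zero, _)] and back, and it retracts by scaling the height. *)
exists (fun ts => K (zero, clamp ((1 - uval ts.2) * uval (tent ts.1)))).
split=> [|t|t|s|s] /=.
- move=> ts; apply: (@continuous_comp _ _ _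
    (fun ts : I * I => (zero, clamp ((1 - uval ts.2) * uval (tent ts.1)))) K); last exact: cK.
  by apply: cont_pair; [move=> ?; exact: cvg_cst|exact: clamp_comp_continuous].
- rewrite uval_zero subr0 mul1r clampK; change (K (zero, tent t) = K (mid t, tent t)).
  have /andP[t0 t1] := uval_itv t.
  have [ta|/ltW ta] := leP (3 * uval t) 1.
    by rewrite /mid clamp_le0//; lra.
  have [tb|/ltW tb] := leP 2 (3 * uval t).
    by rewrite /mid clamp_ge1//; lra.
  have -> : tent t = one by rewrite /tent clamp_ge1// le_min; apply/andP; split; lra.
  by rewrite !K1.
- by rewrite uval_one subrr mul0r clamp_le0// K0 path_zero.
- by rewrite tent0 uval_zero mulr0 clamp_le0// K0 path_zero.
- by rewrite tent1 uval_zero mulr0 clamp_le0// K0 path_zero.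
Qed.

End free_nullhomotopy.

Lemma closed_equalizer (S V : topologicalType) (f g : S -> V) :
  hausdorff_space V -> continuous f -> continuous g -> closed [set s | f s = g s].
Proof.
move=> hV cf cg; rewrite -openC openE => s /eqP fg.
move: hV; rewrite open_hausdorff => /(_ _ _ fg) [[A B] /= [/set_mem As /set_mem Bs]].
move=> [oA oB /eqP AB]; apply: (@filterS _ (nbhs s) _ ((f @^-1` A) `&` (g @^-1` B))).
  move=> x [Ax Bx] /= fgx; suff : (A `&` B) (f x) by rewrite AB.
  by split => //; rewrite fgx.
by apply: filterI; [apply: cf|apply: cg]; apply: open_nbhs_nbhs.
Qed.

Section clamp_interval.
Context {R : realType}.

(** Retraction of the line onto [a, b]. Maps on an interval are extended by it to all of R, which
    keeps continuity absolute rather than relative to a subset. *)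
Definition clampi (a b t : R) : R := Num.max a (Num.min b t).

Lemma clampi_cont a b : continuous (clampi a b).
Proof.
have cmin : continuous (fun t : R => Num.min b t).
  by apply: Defs.min_continuous => t; [exact: cvg_cst|exact: cvg_id].
move=> t; exact: (@continuous_max R R (cst a) _ t (cvg_cst _) (cmin t)).
Qed.

Lemma clampi_itv a b t : a <= b -> a <= clampi a b t <= b.
Proof. by move=> ab; rewrite /clampi le_max lexx /= ge_max ab ge_min lexx. Qed.

Lemma clampi_id a b t : a <= t <= b -> clampi a b t = t.
Proof. by move=> /andP[at' tb]; rewrite /clampi min_r// max_r. Qed.

Lemma clamp_clampi t : clamp (clampi 0 1 t) = clamp t.
Proof.
apply: val_inj => /=; rewrite /clamp_fun (minC t).
by rewrite -/(clampi 0 1 t); have /andP[h0 h1] := clampi_itv t (@ler01 R); rewrite min_l// max_r.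
Qed.

Lemma clampi_left a b e t : a <= b -> b <= e -> t <= b -> clampi a e t = clampi a b t.
Proof. by move=> ab be tb; rewrite /clampi !min_r// (le_trans tb). Qed.

Lemma clampi_right a b e t : a <= b -> b <= e -> b <= t -> clampi a e t = clampi b e t.
Proof.
move=> ab be bt; rewrite /clampi !max_r// le_min ?be ?bt//.
by rewrite (le_trans ab be) (le_trans ab bt).
Qed.

End clamp_interval.

(** * Lifting and monodromy for two-sheeted covers *)

Section double_cover.
Context {R : realType} {T V : topologicalType}.
Local Notation I := (unit_interval R).
(** The cover is given by its fibres [comp A] inside one space [V], without a total space; [deck A]
    exchanges the two points of the fibre over [A]. *)
Variables (comp : T -> V -> Prop) (deck : T -> V -> V).
Hypothesis comp_ex : forall A, exists y, comp A y.
Hypothesis deck_comp : forall A y, comp A y -> comp A (deck A y).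
Hypothesis deck_neq : forall A y, comp A y -> deck A y <> y.
Hypothesis comp_two : forall A y z, comp A y -> comp A z -> z = y \/ z = deck A y.
Hypothesis deck_cont : continuous (fun q : T * V => deck q.1 q.2).
Hypothesis hausdorffV : hausdorff_space V.
Hypothesis local_section : forall A0, exists s : T -> V,
  \forall A \near (A0 : T), comp A (s A) /\ {for A, continuous s}.

Lemma deck_lift_cont (S : topologicalType) (B : S -> T) (y : S -> V) :
  continuous B -> continuous y -> continuous (fun s => deck (B s) (y s)).
Proof.
move=> cB cy s; apply: (@continuous_comp _ _ _ (fun s => (B s, y s))
  (fun q : T * V => deck q.1 q.2)); [exact: cont_pair|exact: deck_cont].
Qed.

(** The set where [z] equals [y] and the set where it is the other point of the fibre are both
    closed, as [V] is Hausdorff, and they are complementary. Since R is connected, one of them is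
    everything. *)
Lemma lift_unique (B : R -> T) (y z : R -> V) :
  continuous B -> continuous y -> continuous z ->
  (forall s, comp (B s) (y s)) -> (forall s, comp (B s) (z s)) ->
  (forall s, z s = y s) \/ (forall s, z s = deck (B s) (y s)).
Proof.
move=> cB cy cz By Bz.
pose E := [set s | z s = y s]; pose E' := [set s | z s = deck (B s) (y s)].
have cE : closed E by apply: closed_equalizer.
have cE' : closed E' by apply: closed_equalizer => //; exact: deck_lift_cont.
have EE' : E = ~` E'.
  apply/seteqP; split => [s /= zy zd|s /= zd].
    by apply: (deck_neq (By s)); rewrite -zd -zy.
  by case: (comp_two (By s) (Bz s)).
have oE : open E by rewrite EE' openC.
have [Ene|E0] := pselect (E !=set0); last first.
  by right=> s; apply: contrapT => zd; apply: E0; exists s; rewrite EE'.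
have cR : connected [set: R] by apply/connected_intervalP.
have ET : E = setT by apply: cR => //; [exists E|exists E]; rewrite ?setTI.
by left=> s; have : E s by rewrite ET.
Qed.

Definition rect_lift (B : R * R -> T) (a b c d : R) := exists2 y : R * R -> V,
  continuous y & forall z, comp (B (clampi a b z.1, clampi c d z.2)) (y z).

Lemma clampi2_cont a b c d :
  continuous (fun z : R * R => (clampi a b z.1, clampi c d z.2)).
Proof.
apply: cont_pair => z.
  by apply: (@continuous_comp _ _ _ fst); [exact: cvg_fst|exact: clampi_cont].
by apply: (@continuous_comp _ _ _ snd); [exact: cvg_snd|exact: clampi_cont].
Qed.

Lemma comp_clampi2_cont (B : R * R -> T) a b c d : continuous B ->
  continuous (fun z : R * R => B (clampi a b z.1, clampi c d z.2)).
Proof.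
move=> cB z; apply: (@continuous_comp _ _ _ (fun z => (clampi a b z.1, clampi c d z.2)) B).
  exact: clampi2_cont.
exact: cB.
Qed.

Lemma section_cont (U : topologicalType) (f : R * R -> U) (b : R) :
  continuous f -> continuous (fun s => f (b, s)).
Proof.
move=> cf s; apply: (@continuous_comp _ _ _ (fun s : R => (b, s)) f); last exact: cf.
by apply: cont_pair => t; [exact: cvg_cst|exact: cvg_id].
Qed.

(* Up to exchanging the two sheets, the two lifts agree on the common side. *)
Lemma rect_lift_hglue (B : R * R -> T) a b e c d : continuous B ->
  a <= b -> b <= e -> rect_lift B a b c d -> rect_lift B b e c d -> rect_lift B a e c d.
Proof.
move=> cB ab be [y cy By] [z0 cz0 Bz0].
have [z [cz Bz yz]] : exists z, [/\ continuous z,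
    forall q, comp (B (clampi b e q.1, clampi c d q.2)) (z q) & forall s, y (b, s) = z (b, s)].
  have cBb : continuous (fun s => B (b, clampi c d s)).
    have h : continuous (fun s : R => B (clampi b b b, clampi c d s)).
      exact: (@section_cont _ _ b (@comp_clampi2_cont B b b c d cB)).
    by move: h; rewrite clampi_id// lexx.
  have z0b s : comp (B (b, clampi c d s)) (z0 (b, s)).
    by have := Bz0 (b, s); rewrite /= clampi_id// lexx be.
  have yb s : comp (B (b, clampi c d s)) (y (b, s)).
    by have := By (b, s); rewrite /= clampi_id// lexx ab.
  have [h|h] := lift_unique cBb (@section_cont _ _ b cz0) (@section_cont _ _ b cy) z0b yb.
    by exists z0.
  exists (fun q => deck (B (clampi b e q.1, clampi c d q.2)) (z0 q)); split.
  - apply: deck_lift_cont => //; exact: comp_clampi2_cont.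
  - by move=> q; exact: deck_comp.
  - by move=> s; rewrite h /= (@clampi_id _ b e b)// lexx be.
exists (fun q => if q.1 <= b then y q else z q).
  by apply: pasting => //; [move=> q; exact: cvg_fst|move=> [q1 q2] /= ->].
move=> q; case: (leP q.1 b) => [qb|/ltW bq].
  by rewrite (clampi_left ab be).
by rewrite (clampi_right ab be).
Qed.

Lemma swap_pair_cont (S U : topologicalType) : continuous (fun q : S * U => (q.2, q.1)).
Proof. by apply: cont_pair => q; [exact: cvg_snd|exact: cvg_fst]. Qed.

Lemma rect_lift_swap (B : R * R -> T) a b c d :
  rect_lift B a b c d -> rect_lift (fun q => B (q.2, q.1)) c d a b.
Proof.
move=> [y cy By]; exists (fun q => y (q.2, q.1)); last by move=> q; exact: By (q.2, q.1).
move=> q; apply: (@continuous_comp _ _ _ (fun q : R * R => (q.2, q.1)) y).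
  exact: swap_pair_cont.
exact: cy.
Qed.

Lemma rect_lift_vglue (B : R * R -> T) a b c d e : continuous B ->
  c <= d -> d <= e -> rect_lift B a b c d -> rect_lift B a b d e -> rect_lift B a b c e.
Proof.
move=> cB cd de /rect_lift_swap l1 /rect_lift_swap l2.
have cB' : continuous (fun q => B (q.2, q.1)).
  move=> q; apply: (@continuous_comp _ _ _ (fun q : R * R => (q.2, q.1)) B).
    exact: swap_pair_cont.
  exact: cB.
have [y cy By] := rect_lift_swap (rect_lift_hglue cB' cd de l1 l2).
by exists y.
Qed.

Lemma rect_lift_local (B : R * R -> T) (z : R * R) : continuous B ->
  exists2 e : R, 0 < e & forall a b c d, a <= b -> c <= d ->
    z.1 - e < a -> b < z.1 + e -> z.2 - e < c -> d < z.2 + e -> rect_lift B a b c d.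
Proof.
move=> cB; have [s sP] := local_section (B z).
have [[N1 N2] /= [/nbhs_ballP[e1 /= e10 N1P] /nbhs_ballP[e2 /= e20 N2P]] NP] := cB z _ sP.
exists (Num.min e1 e2); first by rewrite lt_min e10.
move=> a b c d ab cd za bz zc dz.
have key q : comp (B (clampi a b q.1, clampi c d q.2)) (s (B (clampi a b q.1, clampi c d q.2))) /\
    {for B (clampi a b q.1, clampi c d q.2), continuous s}.
  apply: (NP (_, _)); split=> /=.
    apply: N1P; rewrite /ball /=; have /andP[h1 h2] := clampi_itv q.1 ab.
    by rewrite ltr_distlC; move: za bz; rewrite /Num.min; case: ifP => *; apply/andP; split; lra.
  apply: N2P; rewrite /ball /=; have /andP[h1 h2] := clampi_itv q.2 cd.
  by rewrite ltr_distlC; move: zc dz; rewrite /Num.min; case: ifP => *; apply/andP; split; lra.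
exists (fun q => s (B (clampi a b q.1, clampi c d q.2))); last by move=> q; have [] := key q.
move=> q; apply: (@continuous_comp _ _ _ (fun q => B (clampi a b q.1, clampi c d q.2)) s).
  exact: comp_clampi2_cont.
by have [] := key q.
Qed.

(** Two nested interval inductions. The inner one glues small rectangles around height [s0] into a
    strip of full width; its thickness shrinks at each gluing, which is why the radius is part of
    the predicate. The outer one stacks strips. *)
Lemma square_lift (B : R * R -> T) : continuous B -> rect_lift B 0 1 0 1.
Proof.
move=> cB; suff : (0 : R) <= 1 -> rect_lift B 0 1 0 1 by apply; exact: ler01.
apply: (@interval_ind R (fun c d => c <= d -> rect_lift B 0 1 c d)); last first.
  by move=> a b c ab bc h1 h2 _; apply: (rect_lift_vglue cB ab bc); [exact: h1|exact: h2].
move=> s0 _; suff [e e0 h] : exists2 e : R, 0 < e & (0 : R) <= 1 -> forall c d, c <= d ->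
    s0 - e < c -> d < s0 + e -> rect_lift B 0 1 c d.
  by exists e => // a b _ _ _ h1 h2 ab; exact: h.
apply: (@interval_ind R (fun a b => exists2 e : R, 0 < e & a <= b -> forall c d, c <= d ->
    s0 - e < c -> d < s0 + e -> rect_lift B a b c d)).
  move=> t0 _; have [e e0 h] := rect_lift_local (t0, s0) cB.
  exists e => // a b _ _ _ ta tb; exists e => // ab c d cd sc sd.
  exact: h.
move=> a b c ab bc [e1 e10 h1] [e2 e20 h2]; exists (Num.min e1 e2).
  by rewrite lt_min e10.
move=> _ c0 d0 cd sc sd; have m1 : Num.min e1 e2 <= e1 by rewrite ge_min lexx.
have m2 : Num.min e1 e2 <= e2 by rewrite ge_min lexx orbT.
by apply: (rect_lift_hglue cB ab bc); [apply: h1|apply: h2] => //; lra.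
Qed.

Lemma path_lift (p : I -> T) : continuous p ->
  exists2 y : R -> V, continuous y & forall t, comp (p (clamp t)) (y t).
Proof.
move=> cp; have cB : continuous (fun q : R * R => p (clamp q.2)).
  move=> q; apply: (@continuous_comp _ _ _ snd (fun t => p (clamp t))); first exact: cvg_snd.
  apply: (@continuous_comp _ _ _ clamp p); first exact: clamp_continuous.
  exact: cp.
have [y cy By] := square_lift cB.
exists (fun t => y (0, t)); first exact: (@section_cont _ _ 0).
by move=> t; have := By (0, t); rewrite /= clamp_clampi.
Qed.

Section monodromy.
Variable x0 : T.
Local Notation loop := (@loop R T x0).

(** By [lift_unique] two lifts differ at most by [deck], so if one lift fails to close up, all
    do. *)
Definition monodromy (p : loop) : bool :=
  `[< exists y : R -> V, [/\ continuous y, forall t, comp (p (clamp t)) (y t) & y 0 <> y 1] >].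

Lemma loop_clamp_cont (p : loop) : continuous (fun t => p (clamp t)).
Proof. by apply: path_comp_continuous; exact: clamp_continuous. Qed.

Lemma comp_loop0 (p : loop) (y : R -> V) : (forall t, comp (p (clamp t)) (y t)) -> comp x0 (y 0).
Proof. by move=> /(_ 0); rewrite clamp_le0// path_zero. Qed.

Lemma comp_loop1 (p : loop) (y : R -> V) : (forall t, comp (p (clamp t)) (y t)) -> comp x0 (y 1).
Proof. by move=> /(_ 1); rewrite clamp_ge1// path_one. Qed.

Lemma monodromyP (p : loop) (y : R -> V) : continuous y ->
  (forall t, comp (p (clamp t)) (y t)) -> reflect (y 0 <> y 1) (monodromy p).
Proof.
rewrite /monodromy => cy py; apply: (iffP (asboolP _)) => [|h]; last by exists y.
move=> [z [cz pz z01]] y01; apply: z01.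
have [h|h] := lift_unique (@loop_clamp_cont p) cy cz py pz; rewrite !h ?y01//.
by rewrite clamp_le0// clamp_ge1// path_zero path_one.
Qed.

(** A lift of the homotopy over the square is constant on the two sides where the homotopy rests at
    the base point. Hence its restrictions to bottom and top, which lift [p] and [q], have the same
    end points. *)
Lemma monodromy_homotopic (p q : loop) : homotopic p q -> monodromy p = monodromy q.
Proof.
move=> [H [cH H0 H1 Hx Hy]].
have cB : continuous (fun z : R * R => H (clamp z.1, clamp z.2)).
  move=> z; apply: (@continuous_comp _ _ _ (fun z : R * R => (clamp z.1, clamp z.2)) H); last exact: cH.
  apply: cont_pair => {}z.
    by apply: (@continuous_comp _ _ _ fst); [exact: cvg_fst|exact: clamp_continuous].
  by apply: (@continuous_comp _ _ _ snd); [exact: cvg_snd|exact: clamp_continuous].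
have [y cy] := square_lift cB.
rewrite /= => By0; have {}By z : comp (H (clamp z.1, clamp z.2)) (y z).
  by have := By0 z; rewrite !clamp_clampi.
have csw : continuous (fun q => y (q.2, q.1)).
  move=> z; apply: (@continuous_comp _ _ _ (fun q : R * R => (q.2, q.1)) y).
    exact: swap_pair_cont.
  exact: cy.
have side t : (forall s, H (clamp t, s) = x0) -> y (t, 1) = y (t, 0).
  move=> Ht.
  have yt s : comp x0 (y (t, s)) by have := By (t, s); rewrite /= Ht.
  have cc : continuous (fun _ : R => y (t, 0)) by move=> ?; exact: cvg_cst.
  have cx : continuous (fun _ : R => x0) by move=> ?; exact: cvg_cst.
  have [//|h] := lift_unique cx cc (@section_cont _ _ t cy) (fun=> yt 0) yt.
  by have := deck_neq (yt 0); rewrite -(h 0).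
have p0 t : comp (p (clamp t)) (y (t, 0)).
  by have := By (t, 0); rewrite /= (clamp_le0 (lexx 0)) H0.
have q1 t : comp (q (clamp t)) (y (t, 1)).
  by have := By (t, 1); rewrite /= (clamp_ge1 (lexx 1)) H1.
have e0 : y (0, 1) = y (0, 0) by apply: side => s; rewrite (clamp_le0 (lexx 0)) Hx.
have e1 : y (1, 1) = y (1, 0) by apply: side => s; rewrite (clamp_ge1 (lexx 1)) Hy.
apply/(monodromyP (@section_cont _ _ 0 csw) p0)/(monodromyP (@section_cont _ _ 1 csw) q1);
  by rewrite e0 e1.
Qed.

(** The halves of a lift of the concatenation are lifts of [p] and [q]; as a fibre has two points,
    two exchanges cancel. *)
Lemma monodromy_concat (p q : loop) : monodromy (concat p q) = monodromy p (+) monodromy q.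
Proof.
have [y cy py] := path_lift (@path_continuous _ _ _ _ (concat p q)).
have cl : continuous (fun t : R => y (t * 2^-1)).
  move=> t; apply: (@continuous_comp _ _ _ (fun t : R => t * 2^-1) y); last exact: cy.
  by apply: mulc_continuous => s; exact: cvg_id.
have cr : continuous (fun t : R => y ((t + 1) * 2^-1)).
  move=> t; apply: (@continuous_comp _ _ _ (fun t : R => (t + 1) * 2^-1) y); last exact: cy.
  by apply: mulc_continuous; apply: addc_continuous => s; exact: cvg_id.
have clc (f : R -> V) : continuous f -> continuous (fun t => f (clampi 0 1 t)).
  by move=> cf t; apply: (@continuous_comp _ _ _ (clampi 0 1) f); [exact: clampi_cont|exact: cf].
have pl t : comp (p (clamp t)) (y (clampi 0 1 t * 2^-1)).
  have /andP[t0 t1] := clampi_itv t (@ler01 R).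
  have := py (clampi 0 1 t * 2^-1); rewrite [concat _ _ _]concat_le ?clampE; last first.
  - by apply/andP; split; lra.
  - by lra.
  - by apply/andP; split; lra.
  by rewrite (_ : 2 * (clampi 0 1 t * 2^-1) = clampi 0 1 t) ?clamp_clampi//; field.
have pr t : comp (q (clamp t)) (y ((clampi 0 1 t + 1) * 2^-1)).
  have /andP[t0 t1] := clampi_itv t (@ler01 R).
  have := py ((clampi 0 1 t + 1) * 2^-1); rewrite [concat _ _ _]concat_ge ?clampE; last first.
  - by apply/andP; split; lra.
  - by lra.
  - by apply/andP; split; lra.
  by rewrite (_ : 2 * ((clampi 0 1 t + 1) * 2^-1) - 1 = clampi 0 1 t) ?clamp_clampi//; field.
have c0 : clampi 0 1 0 = 0 :> R by rewrite clampi_id// lexx ler01.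
have c1 : clampi 0 1 1 = 1 :> R by rewrite clampi_id// lexx ler01.
have Mp := monodromyP (clc _ cl) pl; have Mq := monodromyP (clc _ cr) pr.
have M := monodromyP cy py.
move: Mp Mq; rewrite c0 c1 mul0r mul1r add0r mul1r (_ : (1 + 1) * 2^-1 = 1 :> R); last by field.
move=> Mp Mq; have y0 := comp_loop0 py; have y1 := comp_loop1 py.
have yh : comp x0 (y 2^-1).
  by have := comp_loop1 pl; rewrite c1 mul1r.
apply/idP/idP => [/M y01|].
  case: Mp => [yp|/contrapT yp]; case: Mq => [yq|/contrapT yq] //=.
  - have [h|h] := comp_two y0 yh; first by case: yp.
    have [h'|h'] := comp_two y0 y1; first by case: y01.
    by case: yq; rewrite h h'.
  - by case: y01; rewrite yp.
case: Mp => [yp|/contrapT yp]; case: Mq => [yq|/contrapT yq] //= _; apply/M.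
- by rewrite -yq.
- by rewrite yp.
Qed.

Lemma double_cover_pi1 :
  (forall p : loop, monodromy p = false -> homotopic p (cst_path x0)) ->
  (exists p : loop, monodromy p) ->
  group_isomorphic (fundamental_group R T x0) 'Z_2.
Proof.
move=> null [p0 mp0].
(* The group law on ['Z_2] is addition: its group unit is 0, while 1 is the generator. *)
pose f (a : fundamental_group R T x0) : 'Z_2 := if monodromy (repr a) then 1 else 0.
have mE (p : loop) : monodromy (repr (\pi_(fundamental_group R T x0)%qT p)) = monodromy p.
  by apply: monodromy_homotopic; exact: repr_homotopic.
have fM : {morph f : x y / (x * y)%g >-> (x * y)%g}.
  move=> a b; rewrite /f mE monodromy_concat.
  by case: (monodromy _); case: (monodromy _); apply: val_inj.
have f1 : f 1%g = 0.
  by apply: (mulgI (f 1%g)); rewrite -fM mulg1; case: (f 1%g) => [[|[|]]] // i; apply: val_inj.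
have ker a : f a = 0 -> a = 1%g.
  rewrite /f; case: ifP => // m _; rewrite -[a]reprK; apply/pi_homotopic; exact: null.
have fV a : f a^-1%g = f a.
  have := fM a^-1%g a; rewrite mulVg f1.
  by case: (f a) => [[|[|]]] // i; case: (f a^-1%g) => [[|[|]]] // j _; apply: val_inj.
have finj : injective f.
  move=> a b ab; apply: (mulIg b^-1%g); rewrite mulgV; apply: ker.
  by rewrite fM fV ab; case: (f b) => [[|[|]]] // i; apply: val_inj.
pose fm : {multiplicative (fundamental_group R T x0) -> 'Z_2} :=
  HB.pack f (isMultiplicative.Build _ _ f fM).
exists fm; pose a0 := \pi_(fundamental_group R T x0)%qT p0.
have fa0 : f a0 = 1 by rewrite /f mE mp0.
exists (fun x : 'Z_2 => if x == 0 then 1%g else a0).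
  move=> a; apply: finj; case: ifPn => [/eqP fa|fa]; first by rewrite f1 -fa.
  by rewrite fa0; have : f a != 0 := fa; case: (f a) => [[|[|n]] i] // _; apply: val_inj.
move=> x; case: ifPn => [/eqP ->|x0']; first exact: f1.
by rewrite [LHS]fa0; case: x x0' => [[|[|n]] i] // _; apply: val_inj.
Qed.

End monodromy.
End double_cover.

(** * Staircases *)

Section staircase_clock.
Context {R : realType}.

Lemma clampi_le0 (x : R) : x <= 0 -> clampi 0 1 x = 0.
Proof. by move=> x0; rewrite /clampi min_r ?max_l// (le_trans x0). Qed.

Lemma clampi_ge1 (x : R) : 1 <= x -> clampi 0 1 x = 1.
Proof. by move=> x1; rewrite /clampi min_l// max_r. Qed.

Lemma sum_clampi (x : R) n :
  \sum_(i < n) clampi 0 1 (x - i%:R) = clampi 0 n%:R x.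
Proof.
elim: n => [|n IH].
  rewrite big_ord0 /clampi; have [h|/ltW h] := leP 0 x; first by rewrite maxxx.
  by rewrite max_l.
rewrite big_ord_recr /= IH -natr1.
have n0 : (0 : R) <= n%:R by rewrite ler0n.
have [a|/ltW a] := leP x n%:R.
  by rewrite (@clampi_le0 (_ - _)) ?subr_le0// /clampi !min_r ?addr0//; lra.
rewrite /clampi (min_l a) (max_r n0) [in RHS]max_r; last by rewrite le_min; apply/andP; split; lra.
rewrite max_r; last by rewrite le_min; apply/andP; split; lra.
have [c|/ltW c] := leP (n%:R + 1) x; first by rewrite min_l; lra.
by rewrite min_r; lra.
Qed.

(* Over each period of length 1/N, the M clocks advance by 1/N one after the
   other, clock r during the r-th of M equal time slots. *)
Definition clock (M N r : nat) (t : R) : R :=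
  (\sum_(i < N) clampi 0 1 ((M * N)%:R * t - (M * i + r)%:R)) / N%:R.

Lemma clock_cont M N r : continuous (clock M N r).
Proof.
apply: mulc_continuous => t.
apply: cvg_big => /=; first exact: add_continuous.
move=> i _; apply: (@continuous_comp _ _ _ (fun t : R => (M * N)%:R * t - (M * i + r)%:R) (clampi 0 1)).
  apply: addc_continuous => s; apply: cvgM; [exact: cvg_cst|exact: cvg_id].
exact: clampi_cont.
Qed.

Lemma clock0 M N r : clock M N r 0 = 0.
Proof.
rewrite /clock big1 ?mul0r// => i _.
by rewrite mulr0 add0r clampi_le0// oppr_le0 ler0n.
Qed.

Lemma clock1 M N r : (r < M)%N -> (0 < N)%N -> clock M N r 1 = 1.
Proof.
move=> rM N0; rewrite /clock (eq_bigr (fun=> 1)) => [|i _].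
  by rewrite sumr_const card_ord divff// pnatr_eq0 -lt0n.
rewrite mulr1 clampi_ge1// lerBrDr nat1r ler_nat.
rewrite (@leq_trans (M * i + M))//; first by rewrite -addnS leq_add2l.
by rewrite addnC -mulnS leq_mul2l ltn_ord orbT.
Qed.

(** With x = N t, the i-th ramp of the clock rises between i and i + 1. So it lies above the unit
    ramp from i + 1 to i + 2 and below the one from i - 1 to i; by [sum_clampi] these add up, after
    clamping, to x - 1 and x + 1. *)
Lemma clock_near M N r t : (r < M)%N -> (0 < N)%N -> 0 <= t <= 1 ->
  `|clock M N r t - t| <= N%:R^-1.
Proof.
move=> rM N0 /andP[t0 t1].
have N0' : (0 : R) < N%:R by rewrite ltr0n.
pose x : R := N%:R * t.
have x0 : 0 <= x by rewrite mulr_ge0// ltW.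
have xN : x <= N%:R by rewrite ler_piMr// ltW.
pose S := \sum_(i < N) clampi 0 1 ((M * N)%:R * t - (M * i + r)%:R).
have termE (i : nat) : (M * N)%:R * t - (M * i + r)%:R = M%:R * (x - i%:R) - r%:R :> R.
  by rewrite /x natrM natrD natrM; ring.
have rM' : r%:R + 1 <= M%:R :> R by rewrite natr1 ler_nat.
have r0' : 0 <= r%:R :> R by rewrite ler0n.
have Sl : x - 1 <= S.
  apply: (@le_trans _ _ (\sum_(i < N) clampi 0 1 ((x - 1) - i%:R))).
    by rewrite sum_clampi /clampi min_r ?le_max ?lexx ?orbT//; lra.
  apply: ler_sum => i _; rewrite termE; set y := x - i%:R.
  rewrite (_ : x - 1 - i%:R = y - 1); last by rewrite /y; ring.
  have [y1|/ltW y1] := leP y 1.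
    by rewrite clampi_le0 ?subr_le0//; have /andP[] := @clampi_itv R 0 1 (M%:R * y - r%:R) ler01.
  rewrite (@clampi_ge1 (_ * _ - _)); first by have /andP[] := @clampi_itv R 0 1 (y - 1) ler01.
  have : M%:R <= M%:R * y by rewrite ler_peMr//; lra.
  lra.
have Su : S <= x + 1.
  apply: (@le_trans _ _ (\sum_(i < N) clampi 0 1 ((x + 1) - i%:R))); last first.
    by rewrite sum_clampi /clampi ge_max ge_min lexx orbT andbT; lra.
  apply: ler_sum => i _; rewrite termE; set y := x - i%:R.
  rewrite (_ : x + 1 - i%:R = y + 1); last by rewrite /y; ring.
  have [y0|/ltW y0] := leP 0 y.
    by rewrite (@clampi_ge1 (y + 1)) ?lerDr//; have /andP[] := @clampi_itv R 0 1 (M%:R * y - r%:R) ler01.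
  rewrite (@clampi_le0 (_ * _ - _)); first by have /andP[] := @clampi_itv R 0 1 (y + 1) ler01.
  have : M%:R * y <= 0 by rewrite mulr_ge0_le0//; lra.
  lra.
rewrite -[X in clock M N r t - X](@mulfK _ (N%:R : R) _ t) ?gt_eqF//.
rewrite /clock -/S -mulrBl normrM (ger0_norm (_ : 0 <= N%:R^-1)); last by rewrite invr_ge0 ltW.
rewrite ler_piMl ?invr_ge0 ?(ltW N0')// ler_norml mulrC -/x; apply/andP; split; lra.
Qed.

(** During time slot [n0], the integer part of M N t, only the clock [n0 %% M] moves. Any other
    clock has completed its ramps with slot below [n0] and not begun the later ones; [k] counts the
    completed ramps. *)
Lemma clock_stuck M N t : (0 < N)%N -> 0 <= t -> exists r0, forall r, (r < M)%N -> (r != r0)%N ->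
  exists2 k, (k <= N)%N & clock M N r t = k%:R / N%:R.
Proof.
move=> N0 t0; have s0 : 0 <= (M * N)%:R * t by rewrite mulr_ge0.
pose n0 := Num.truncn ((M * N)%:R * t).
have /andP[n0l n0u] : n0%:R <= (M * N)%:R * t < n0.+1%:R by rewrite truncn_itv.
exists (n0 %% M)%N => r rM rr0.
exists (\sum_(i < N) (M * i + r < n0)%N)%N.
  rewrite (@leq_trans (\sum_(i < N) 1)%N)//; last by rewrite sum1_card card_ord.
  by apply: leq_sum => i _; case: (_ < _)%N.
rewrite /clock natr_sum; congr (_ / _); apply: eq_bigr => i _.
have neq : (M * i + r != n0)%N.
  by apply: contraNneq rr0 => <-; rewrite mulnC modnMDl modn_small.
move: neq; rewrite neq_ltn => /orP[lt|gt].
  rewrite lt clampi_ge1//; have : (M * i + r)%:R + 1 <= n0%:R :> R by rewrite natr1 ler_nat.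
  lra.
rewrite (ltnNge _ n0) (ltnW gt) /= clampi_le0//.
have : n0.+1%:R <= (M * i + r)%:R :> R by rewrite ler_nat.
lra.
Qed.

(** A Lebesgue number for the diagonal of the cube of times: separate times for the coordinates are
    harmless as long as they stay uniformly close to a common one. *)
Lemma uniform_near_diagonal (J : finType) (P : (J -> R) -> Prop) :
  (forall t, 0 <= t <= 1 -> exists2 e, 0 < e & forall tau, (forall c, `|tau c - t| < e) -> P tau) ->
  exists2 e, 0 < e & forall t tau, 0 <= t <= 1 -> (forall c, `|tau c - t| < e) -> P tau.
Proof.
move=> loc.
suff [e e0 h] : exists2 e, 0 < e & forall t tau, 0 <= t <= 1 ->
    (forall c, `|tau c - t| < e) -> P tau by exists e.
apply: (@interval_ind R (fun a b => exists2 e, 0 < e & forall t tau, a <= t <= b ->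
    (forall c, `|tau c - t| < e) -> P tau)).
  move=> x x01; have [e e0 h] := loc x x01; exists (e / 2); first by rewrite divr_gt0.
  move=> a b a0 ab b1 xa bx; exists (e / 2); first by rewrite divr_gt0.
  move=> t tau /andP[at' tb] near; apply: h => c.
  have tx : `|t - x| < e / 2 by rewrite ltr_distl; apply/andP; split; lra.
  rewrite (_ : tau c - x = (tau c - t) + (t - x)); last by ring.
  by apply: (le_lt_trans (ler_normD _ _)); have := near c; lra.
move=> a b c ab bc [e1 e10 h1] [e2 e20 h2]; exists (Num.min e1 e2).
  by rewrite lt_min e10.
move=> t tau /andP[at' tc] near; have [tb|/ltW bt] := leP t b.
  apply: (h1 t) => [|x]; first by rewrite at'.
  by apply: lt_le_trans (near x) _; rewrite ge_min lexx.
apply: (h2 t) => [|x]; first by rewrite bt.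
by apply: lt_le_trans (near x) _; rewrite ge_min lexx orbT.
Qed.

Lemma finite_positive (I : finType) (P : I -> R -> Prop) :
  (forall i e e', e' <= e -> P i e -> P i e') ->
  (forall i, exists2 e, 0 < e & P i e) -> exists2 e, 0 < e & forall i, P i e.
Proof.
move=> mon /(_ _)/cid2 h.
pose f i := sval (h i).
suff [e e0 eP] : exists2 e : R, 0 < e & forall i, i \in enum I -> e <= f i.
  exists e => // i; apply: (mon _ (f i)); first by apply: eP; rewrite mem_enum.
  by rewrite /f; case: (h i).
elim: (enum I) => [|i s [e e0 eP]]; first by exists 1.
exists (Num.min (f i) e); first by rewrite lt_min e0 andbT /f; case: (h i).
move=> j; rewrite inE => /predU1P[->|/eP ej]; first by rewrite ge_min lexx.
by rewrite ge_min ej orbT.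
Qed.

End staircase_clock.

(** * Loops avoiding a set of codimension two *)

Section generic_points.
Context {R : realType} {d : nat} (N : 'I_d -> nat).
Local Notation C := R[i].

Definition coords := forall j : 'I_d, 'I_(N j) -> C.
Definition cidx : finType := {j : 'I_d & 'I_(N j)}.
Definition entry (x : coords) (c : cidx) : C := x (tag c) (tagged c).
Definition cix (j : 'I_d) (k : 'I_(N j)) : cidx := Tagged (fun j => 'I_(N j)) k.

Definition segment (s : R) (x p : coords) : coords :=
  fun j k => (1 - s%:C) * x j k + s%:C * p j k.

Arguments segment : clear implicits.

(** [F] pairs a functional with its value at the start of a segment. On a segment ending at [p] the
    functional can vanish at a nonzero parameter only if its value at [p] is a real multiple of the
    starting value. *)
Definition avoids (p : coords) (F : (coords -> C) * C) := forall r : R, F.1 p != r%:C * F.2.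

Definition realizable (F : (coords -> C) * C) :=
  (forall p q (e : R), F.1 (fun j k => p j k + e%:C * q j k) = F.1 p + e%:C * F.1 q) /\
  exists q, avoids q F.

Lemma not_real_multiple (b : C) : exists w : C, forall r : R, w != r%:C * b.
Proof.
have [->|b0] := eqVneq b 0; first by exists 1 => r; rewrite mulr0 oner_neq0.
exists ('i%C * b) => r; rewrite (inj_eq (mulIf b0)) eq_complex /=.
by rewrite oner_eq0 andbF.
Qed.

Lemma realizable_pair (a a' b : C) (c c' : cidx) : a != 0 -> (a' == 0) || (c != c') ->
  realizable (fun p => a * entry p c + a' * entry p c', b).
Proof.
move=> a0 ac; split=> [p q e /=|]; first by rewrite /entry; ring.
have [w wb] := not_real_multiple b.
exists (fun j k => if cix k == c then a^-1 * w else 0) => r /=.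
have E x : entry (fun j k => if cix k == c then a^-1 * w else 0) x =
    if x == c then a^-1 * w else 0 by rewrite /entry /cix; case: x.
rewrite !E eqxx (mulVKf a0).
move: ac => /orP[/eqP ->|/negbTE cc]; first by rewrite mul0r addr0; exact: wb.
by rewrite (eq_sym c') cc mulr0 addr0; exact: wb.
Qed.

(* On the line through p and q at most one point violates each condition. *)
Lemma generic_point (I : finType) (F : I -> (coords -> C) * C) :
  (forall i, realizable (F i)) -> exists p, forall i, avoids p (F i).
Proof.
move=> rF; suff [p pP] : exists p, forall i, i \in enum I -> avoids p (F i).
  by exists p => i; apply: pP; rewrite mem_enum.
elim: (enum I) => [|i s [p pP]]; first by exists (fun _ _ => 0).
have [_ [q qP]] := rF i.
pose pq (n : nat) : coords := fun j k => p j k + (n%:R : R)%:C * q j k.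
have one j : avoids p (F j) \/ avoids q (F j) -> exists n0, forall n, (n0 <= n)%N -> avoids (pq n) (F j).
  move=> pqj; have [[n0 bad]|nobad] := pselect (exists n, ~ avoids (pq n) (F j)); last first.
    by exists 0%N => n _; apply: contrapT => h; apply: nobad; exists n.
  exists n0.+1 => n n0n r; apply/negP => /eqP e1.
  move: bad => /existsNP[r0 /negP]; rewrite negbK => /eqP e0.
  have [lin _] := rF j; move: e1 e0; rewrite /pq !lin.
  set P := (F j).1 p; set Q := (F j).1 q; set b := (F j).2 => e1 e0.
  have nn0 : (n%:R - n0%:R : R) != 0 by rewrite subr_eq0 eqr_nat neq_ltn n0n orbT.
  have nn0C : ((n%:R - n0%:R : R)%:C : C) != 0.
    by apply: contraNneq nn0 => /(congr1 (@complex.Re R)) /= ->.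
  (* Subtracting the violations at [n] and [n0] makes [Q], and then [P], a real multiple of [b], so
     neither [p] nor [q] would avoid the condition. *)
  pose rr : R := (r - r0) / (n%:R - n0%:R).
  have eQ : Q = rr%:C * b.
    apply: (mulfI nn0C); rewrite mulrA -rmorphM.
    rewrite (_ : (n%:R - n0%:R) * rr = r - r0); last by rewrite mulrC divfK.
    rewrite !rmorphB.
    transitivity ((P + (n%:R : R)%:C * Q) - (P + (n0%:R : R)%:C * Q)); first by rewrite /=; ring.
    by rewrite e1 e0; ring.
  clearbody rr.
  have eP : P = (r - n%:R * rr)%:C * b.
    transitivity ((P + (n%:R : R)%:C * Q) - (n%:R : R)%:C * Q); first by ring.
    by rewrite e1 eQ rmorphB rmorphM mulrBl mulrA.
  by case: pqj => [/(_ (r - n%:R * rr))/eqP|/(_ rr)/eqP]; apply.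
suff [n0 n0P] : exists n0, forall j, j \in i :: s -> forall n, (n0 <= n)%N -> avoids (pq n) (F j).
  by exists (pq n0) => j js; exact: n0P.
have all1 j : j \in i :: s -> exists n0, forall n, (n0 <= n)%N -> avoids (pq n) (F j).
  by rewrite inE => /predU1P[->|/pP pj]; apply: one; [right|left].
elim: (i :: s) all1 => [|j s' IH] all1; first by exists 0%N.
have [|n1 n1P] := IH; first by move=> k ks; apply: all1; rewrite inE ks orbT.
have [|n2 n2P] := all1 j; first by rewrite inE eqxx.
exists (maxn n1 n2) => k; rewrite inE => /predU1P[->|ks] n; rewrite geq_max => /andP[h1 h2].
  exact: n2P.
exact: n1P.
Qed.

Definition indep_at (j : 'I_d) (u v : coords) :=
  exists x y : 'I_(N j), u j x * v j y != u j y * v j x.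

(* [good true] asks for independence outside any two places, i.e. in at least
   three of them; [good false] is the condition for part (i). *)
Definition good (b : bool) (u v : coords) := [/\ forall j, exists k, u j k != 0,
  forall j, exists k, v j k != 0 &
  b -> forall i j, exists l, [/\ l != i, l != j & indep_at l u v]].

Lemma indep_at_sym j u v : indep_at j u v -> indep_at j v u.
Proof. by move=> [x [y xy]]; exists y, x; rewrite mulrC (mulrC (v j x)). Qed.

Lemma good_sym b u v : good b u v -> good b v u.
Proof.
move=> [u0 v0 uv]; split=> // /uv {}uv i j; have [l [li lj luv]] := uv i j.
by exists l; split=> //; exact: indep_at_sym.
Qed.

Lemma coordsP (x y : coords) : (forall j k, x j k = y j k) -> x = y.
Proof.
by move=> xy; apply: functional_extensionality_dep => j; apply: functional_extensionality_dep.
Qed.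

Lemma segment0 x p : segment 0 x p = x.
Proof. by apply: coordsP => j k; rewrite /segment subr0 mul1r mul0r addr0. Qed.

Lemma segment1 x p : segment 1 x p = p.
Proof. by apply: coordsP => j k; rewrite /segment subrr mul0r mul1r add0r. Qed.

(* Outside any two places, some factor has a functional that kills a given
   vector and ignores the coordinate c: the bad pairs have codimension at least
   two. *)
Definition roomy (b : bool) := (forall j, 1 < N j)%N /\ (b -> forall i j (c : cidx),
  exists l, [/\ l != i, l != j & exists x y : 'I_(N l), [/\ x != y, cix x != c & cix y != c]]).

Definition agree_off (c : cidx) (x y : coords) := forall j (k : 'I_(N j)), cix k != c -> x j k = y j k.

Lemma exists_off (c : cidx) j : (1 < N j)%N -> exists k : 'I_(N j), cix k != c.
Proof.
move=> Nj; pose k0 : 'I_(N j) := Ordinal (ltnW Nj); pose k1 : 'I_(N j) := Ordinal Nj.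
have [e0|] := eqVneq (cix k0) c; last by exists k0.
exists k1; rewrite -e0; apply/eqP => /eqP; rewrite /cix eq_Tagged /= => /eqP/(congr1 val).
by [].
Qed.

(** The end point of a segment in terms of the start and a point in between, with real coefficients.
    For w = 0 it exhibits [p] as a real multiple of [b]. *)
Lemma realC_scale (s : R) (b w p : C) : s != 0 -> (1 - s%:C) * b + s%:C * p = w ->
  p = (s^-1)%:C * w + (- (1 - s) / s)%:C * b.
Proof.
move=> s0 <-; have s0C : (s%:C : C) != 0.
  by apply: contraNneq s0 => /(congr1 (@complex.Re R)) /= ->.
by rewrite rmorphM rmorphN rmorphB !fmorphV /=; field.
Qed.

(* If the cone over the piece through (a, e) meets the bad set, then a functional
   killing a and ignoring the moving coordinate takes at p a real multiple of its
   value at e. *)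
Lemma cone (b : bool) (P : finType) (c : P -> cidx) (a e : P -> coords) : roomy b ->
  exists p, forall pi u v, agree_off (c pi) u (a pi) -> agree_off (c pi) v (e pi) ->
    good b u v -> forall s, 0 <= s <= 1 -> good b u (segment s v p).
Proof.
move=> [N1 room].
have nz (pj : P * 'I_d) : exists F, realizable F /\ forall p, avoids p F ->
    forall u v, agree_off (c pj.1) v (e pj.1) -> good b u v ->
    forall s, 0 <= s <= 1 -> exists k, segment s v p pj.2 k != 0.
  move: pj => [pi j] /=; have [k kc] := exists_off (c pi) (N1 j).
  exists (fun p => 1 * entry p (cix k) + 0 * entry p (cix k), e pi j k).
  split; first by apply: realizable_pair; rewrite ?oner_neq0 ?eqxx.
  move=> p pF u v ve [_ v0 _] s _; have [->|s0] := eqVneq s 0.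
    by rewrite segment0; exact: v0.
  exists k; apply/negP => /eqP /(realC_scale s0); rewrite ve// mulr0 add0r => pk.
  by have /eqP := pF (- (1 - s) / s); rewrite /= mul1r mul0r addr0; apply.
have ind (pij : P * ('I_d * 'I_d)) : exists F, realizable F /\ forall p, avoids p F ->
    forall u v, agree_off (c pij.1) u (a pij.1) -> agree_off (c pij.1) v (e pij.1) ->
    good b u v -> b -> forall s, 0 <= s <= 1 ->
    exists l, [/\ l != pij.2.1, l != pij.2.2 & indep_at l u (segment s v p)].
  move: pij => [pi [i j]] /=; have [bT|bF] := pselect (b : Prop); last first.
    exists (fun p => 1 * entry p (c pi) + 0 * entry p (c pi), 0).
    by split; [apply: realizable_pair; rewrite ?oner_neq0 ?eqxx|].
  have [l [li lj [x [y [xy xc yc]]]]] := room bT i j (c pi).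
  have cxy : cix x != cix y by rewrite /cix eq_Tagged.
  (* If [a] vanishes at both [x] and [y], their minor is zero. Then any [z] with a nonzero entry of
     [u], possibly the moving one, is paired with [x]: the minor is the entry of [u] at [z] times
     that of the segment at [x]. *)
  have [[ax ay]|axy] := pselect (a pi l x = 0 /\ a pi l y = 0).
    exists (fun p => 1 * entry p (cix x) + 0 * entry p (cix x), e pi l x).
    split; first by apply: realizable_pair; rewrite ?oner_neq0 ?eqxx.
    move=> p pF u v ua ve [u0 v0 uv] _ s _; have [->|s0] := eqVneq s 0.
      by rewrite segment0; exact: uv.
    exists l; split=> //; have [z uz] := u0 l; exists z, x.
    rewrite (ua _ x)// ax mul0r mulf_neq0//.
    apply/negP => /eqP /(realC_scale s0); rewrite ve// mulr0 add0r => pk.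
    by have /eqP := pF (- (1 - s) / s); rewrite /= mul1r mul0r addr0; apply.
  (* The functional with kernel spanned by [a] in the coordinates [x] and [y]; its value along the
     segment is the 2x2 minor against [a]. *)
  pose f (p : coords) := a pi l y * entry p (cix x) + (- a pi l x) * entry p (cix y).
  exists (f, f (e pi)); split.
    have [ay0|ay0] := eqVneq (a pi l y) 0; last first.
      by apply: realizable_pair => //; rewrite cxy orbT.
    have ax0 : - a pi l x != 0.
      by rewrite oppr_eq0; apply/eqP => ax0; apply: axy.
    have := @realizable_pair _ (a pi l y) (f (e pi)) (cix y) (cix x) ax0.
    rewrite ay0 eqxx => /(_ isT); congr (realizable (_, _)).
    by apply/funext => p; rewrite /f ay0 addrC.
  move=> p pF u v ua ve [u0 v0 uv] _ s _; have [->|s0] := eqVneq s 0.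
    by rewrite segment0; exact: uv.
  exists l; split=> //; exists x, y; rewrite !ua//; apply/eqP => eq.
  have : (1 - s%:C) * f (e pi) + s%:C * f p = 0.
    rewrite /f /entry /= -(ve _ x)// -(ve _ y)//.
    transitivity (a pi l y * segment s v p l x - a pi l x * segment s v p l y).
      by rewrite /segment; ring.
    by rewrite eq subrr.
  by move=> /(realC_scale s0); rewrite mulr0 add0r => /eqP; apply/negP; exact: pF.
have /choice[F1 F1P] := nz; have /choice[F2 F2P] := ind.
pose F (x : (P * 'I_d) + (P * ('I_d * 'I_d))) := match x with inl y => F1 y | inr y => F2 y end.
have [p pF] : exists p, forall x, avoids p (F x).
  by apply: generic_point => -[y|y]; [case: (F1P y)|case: (F2P y)].
exists p => pi u v ua ve g s s01; have [u0 v0 uv] := g; split=> // [j|bT i j].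
  have [_ /(_ p (pF (inl (pi, j)))) h] := F1P (pi, j); exact: (h u v).
by have [_ /(_ p (pF (inr (pi, (i, j))))) h] := F2P (pi, (i, j)); exact: (h u v).
Qed.

End generic_points.

(** * Contracting loops of admissible pairs and exchanging the members of a pair *)

Section null_homotopy.
Context {R : realType} {d : nat} (N : 'I_d -> nat).
Local Notation C := R[i].
Local Notation coords := (@coords R d N).
Local Notation cidx := (cidx N).

Definition coords_cont (S : topologicalType) (u : S -> coords) :=
  forall s j k, ccont s (fun x => u x j k).

Lemma itv01_one : 0 <= (1 : R) <= 1.
Proof. by apply/andP; split; [exact: ler01|exact: lexx]. Qed.

Definition ev (u : R -> coords) (tau : cidx -> R) : coords :=
  fun j k => u (tau (cix k)) j k.

Arguments ev : clear implicits.

Lemma ccont_near0 (f : R -> C) t : ccont t f -> f t != 0 ->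
  exists2 e, 0 < e & forall s, `|s - t| < e -> f s != 0.
Proof.
move=> cf f0; have /nbhs_ballP[e /= e0 h] := ccont_neq0 cf f0.
by exists e => // s st; apply: h; rewrite /ball /= distrC.
Qed.

(** A minor involves two coordinates, which run on different clocks, but each coordinate has the
    same clock in [u] and [v]: hence two times [s] and [s'], each used twice. *)
Lemma ccont_near_minor (f1 f2 f3 f4 : R -> C) t :
  ccont t f1 -> ccont t f2 -> ccont t f3 -> ccont t f4 -> f1 t * f2 t != f3 t * f4 t ->
  exists2 e, 0 < e & forall s s', `|s - t| < e -> `|s' - t| < e ->
    f1 s * f2 s' != f3 s' * f4 s.
Proof.
move=> c1 c2 c3 c4; rewrite -subr_eq0 => f0.
have cm : ccont (t, t) (fun z : R * R => f1 z.1 * f2 z.2 - f3 z.2 * f4 z.1).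
  by apply: ccontB; apply: ccontM; [exact: ccont_fst|exact: ccont_snd|exact: ccont_snd|exact: ccont_fst].
have [[N1 N2] /= [/nbhs_ballP[e1 /= e10 N1P] /nbhs_ballP[e2 /= e20 N2P]] NP] := ccont_neq0 cm f0.
exists (Num.min e1 e2); first by rewrite lt_min e10.
move=> s s'; rewrite !lt_min => /andP[s1 _] /andP[_ s2].
rewrite -subr_eq0; apply: (NP (s, s')); split=> /=.
  by apply: N1P; rewrite /ball /= distrC.
by apply: N2P; rewrite /ball /= distrC.
Qed.

Lemma good_near (b : bool) (u v : R -> coords) t : coords_cont u -> coords_cont v ->
  good b (u t) (v t) -> exists2 e, 0 < e & forall tau, (forall c, `|tau c - t| < e) ->
    good b (ev u tau) (ev v tau).
Proof.
move=> cu cv [u0 v0 uv].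
have nz (w : R -> coords) : coords_cont w -> (forall j, exists k, w t j k != 0) ->
    exists2 e, 0 < e & forall j tau, (forall c, `|tau c - t| < e) -> exists k, ev w tau j k != 0.
  move=> cw w0; apply: finite_positive => [j e e' e'e h tau near|j].
    by apply: h => c; apply: lt_le_trans e'e.
  have [k wk] := w0 j; have [e e0 h] := ccont_near0 (cw t j k) wk.
  by exists e => // tau near; exists k; apply: h.
have [e1 e10 h1] := nz u cu u0; have [e2 e20 h2] := nz v cv v0.
have [e3 e30 h3] : exists2 e, 0 < e & forall (ij : 'I_d * 'I_d) tau, (forall c, `|tau c - t| < e) ->
    b -> exists l, [/\ l != ij.1, l != ij.2 & indep_at l (ev u tau) (ev v tau)].
  apply: finite_positive => [ij e e' e'e h tau near|[i j]].
    by apply: h => c; apply: lt_le_trans e'e.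
  have [bT|bF] := pselect (b : Prop); last by exists 1.
  have [l [li lj [x [y xy]]]] := uv bT i j.
  have [e e0 h] := ccont_near_minor (cu t l x) (cv t l y) (cu t l y) (cv t l x) xy.
  by exists e => // tau near _; exists l; split=> //; exists x, y; apply: h.
exists (Num.min e1 (Num.min e2 e3)); first by rewrite !lt_min e10 e20.
move=> tau near.
have n1 c : `|tau c - t| < e1 by apply: lt_le_trans (near c) _; rewrite ge_min lexx.
have n2 c : `|tau c - t| < e2 by apply: lt_le_trans (near c) _; rewrite !ge_min lexx orbT.
have n3 c : `|tau c - t| < e3 by apply: lt_le_trans (near c) _; rewrite !ge_min lexx !orbT.
by split=> [j|j|bT i j]; [exact: h1|exact: h2|exact: (h3 (i, j))].
Qed.

(* First move the coordinates one at a time along a staircase, then contract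
   the second vector, then the first one, to a generic point. *)
Lemma good_loop_null (b : bool) (u v : R -> coords) : (0 < d)%N -> roomy N b ->
  coords_cont u -> coords_cont v ->
  (forall t : R, 0 <= t <= 1 -> good b (u t) (v t)) -> u 0 = u 1 -> v 0 = v 1 ->
  exists Ku Kv : R * R -> coords, [/\ coords_cont Ku, coords_cont Kv,
    forall t s : R, 0 <= t <= 1 -> 0 <= s <= 1 -> good b (Ku (t, s)) (Kv (t, s)) &
    [/\ forall t, Ku (t, 0) = u t /\ Kv (t, 0) = v t,
        exists p q, forall t, Ku (t, 1) = q /\ Kv (t, 1) = p &
        forall s, Ku (0, s) = Ku (1, s) /\ Kv (0, s) = Kv (1, s)]].
Proof.
move=> d0 room cu cv guv u01 v01.
have [e e0 near] : exists2 e, 0 < e & forall t tau, 0 <= t <= 1 ->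
    (forall c : cidx, `|tau c - t| < e) -> good b (ev u tau) (ev v tau).
  by apply: uniform_near_diagonal => t t01; apply: good_near => //; exact: guv.
pose n := (Num.truncn e^-1).+1.
have n0 : (0 < n)%N by [].
have ne : n%:R^-1 < e.
  by rewrite invf_plt ?posrE ?ltr0n// truncnS_gt.
pose j0 : 'I_d := Ordinal d0; pose k0 : 'I_(N j0) := Ordinal (ltnW (room.1 j0)).
pose M := #|cidx|.
pose phi (c : cidx) (t : R) : R := clock M n (enum_rank c) t.
have phi0 c : phi c 0 = 0 by exact: clock0.
have phi1 c : phi c 1 = 1 by exact: clock1.
have phin c (t : R) : 0 <= t <= 1 -> `|phi c t - t| < e.
  by move=> t01; apply: le_lt_trans ne; apply: clock_near.
(* Interpolates from the common time [t] to the separate clocks; all intermediate times stay within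
   [e] of [t]. *)
pose tau (t s : R) (c : cidx) : R := (1 - s) * t + s * phi c t.
have taun (t s : R) : 0 <= t <= 1 -> 0 <= s <= 1 -> forall c, `|tau t s c - t| < e.
  move=> t01 /andP[s0 s1] c; rewrite (_ : _ - t = s * (phi c t - t)); last by rewrite /tau; ring.
  rewrite normrM (ger0_norm s0); apply: le_lt_trans (phin c t t01).
  by rewrite ler_piMl.
(* A piece of the staircase: the moving coordinate, together with clock readings as multiples of
   1/n. *)
pose P : finType := (cidx * {ffun cidx -> 'I_n.+1})%type.
pose base (w : R -> coords) (pi : P) := ev w (fun c => (pi.2 c)%:R / n%:R).
have stair (t : R) : 0 <= t <= 1 -> exists pi : P, forall w, agree_off pi.1 (ev w (tau t 1)) (base w pi).
  move=> /andP[t0 t1]; have [r0 r0P] := clock_stuck M n0 t0.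
  have [/existsP[c0 /eqP c0r]|no] := boolP [exists c : cidx, enum_rank c == r0 :> nat].
    have /choice[kap kapP] : forall c : cidx, exists k : 'I_n.+1,
        c != c0 -> phi c t = k%:R / n%:R.
      move=> c; have [->|cc] := eqVneq c c0; first by exists ord0.
      have [||k kn e1] := r0P (enum_rank c); first exact: ltn_ord.
        by apply: contraNneq cc => cr; apply/eqP/enum_rank_inj/val_inj; rewrite /= cr.
      by exists (Ordinal (kn : (k < n.+1)%N)).
    exists (c0, [ffun c => kap c]) => w j k /= kc.
    by rewrite /base /ev /= ffunE -kapP// /tau subrr mul0r add0r mul1r.
  (* If [r0] numbers no coordinate, all clocks read multiples of 1/n and [cix k0] may be declared
     the moving coordinate. *)
  have /choice[kap kapP] : forall c : cidx, exists k : 'I_n.+1, phi c t = k%:R / n%:R.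
    move=> c; have [||k kn e1] := r0P (enum_rank c); first exact: ltn_ord.
      by apply: contra no => /eqP cr; apply/existsP; exists c; apply/eqP.
    by exists (Ordinal (kn : (k < n.+1)%N)).
  exists (cix k0, [ffun c => kap c]) => w j k /= kc.
  by rewrite /base /ev /= ffunE -kapP// /tau subrr mul0r add0r mul1r.
have [p pP] := cone fst (base u) (base v) room.
(* When the first vector is contracted, the second one already rests at [p]; the roles are exchanged
   by [good_sym]. *)
have [q qP] := cone fst (fun=> p) (base u) room.
(* The three stages occupy the thirds of the parameter interval. *)
pose c1 (s : R) := clampi 0 1 (3 * s).
pose c2 (s : R) := clampi 0 1 (3 * s - 1).
pose c3 (s : R) := clampi 0 1 (3 * s - 2).
pose Ku (z : R * R) := segment (c3 z.2) (ev u (tau z.1 (c1 z.2))) q.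
pose Kv (z : R * R) := segment (c2 z.2) (ev v (tau z.1 (c1 z.2))) p.
have cc (c : R) : continuous (fun z : R * R => clampi 0 1 (3 * z.2 + c)).
  move=> z; apply: (@continuous_comp _ _ _ (fun z : R * R => 3 * z.2 + c) (clampi 0 1)); last exact: clampi_cont.
  apply: addc_continuous => {}z; apply: cvgM; [exact: cvg_cst|exact: cvg_snd].
have cc1 : continuous (fun z : R * R => c1 z.2).
  by have := cc 0; rewrite /c1; under eq_fun do rewrite addr0.
have ctau c : continuous (fun z : R * R => tau z.1 (c1 z.2) c).
  have cphi : continuous (fun z : R * R => phi c z.1).
    move=> z; apply: (@continuous_comp _ _ _ fst (phi c)); [exact: cvg_fst|exact: clock_cont].
  move=> z; apply: cvgD; last by apply: cvgM; [exact: cc1|exact: cphi].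
  by apply: cvgM; [exact: (onem_continuous cc1)|exact: cvg_fst].
have cK (c : R) w r : coords_cont w ->
    coords_cont (fun z : R * R => segment (clampi 0 1 (3 * z.2 + c)) (ev w (tau z.1 (c1 z.2))) r).
  move=> cw z j k; rewrite /segment; have cz := ccont_real (cc c z).
  apply: ccontD; last by apply: ccontM => //; exact: ccont_cst.
  apply: ccontM; first by apply: ccontB => //; exact: ccont_cst.
  by apply: (ccont_comp (ctau (cix k) z) (cw _ j k)).
have tau0 t : tau t 0 = fun=> t.
  by apply/funext => c; rewrite /tau subr0 mul1r mul0r addr0.
have evc w t : ev w (fun=> t) = w t by exact: coordsP.
exists Ku, Kv; split; [exact: cK|exact: cK| |split].
- move=> t s t01 /andP[s0 s1]; rewrite /Ku /Kv /=.
  have c01 (x : R) : 0 <= clampi 0 1 x <= 1 by apply: clampi_itv; exact: ler01.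
  have [sa|/ltW sa] := leP (3 * s) 1.
    rewrite /c2 /c3 !clampi_le0 ?segment0; [|lra..].
    by apply: (near t) => // c; apply: taun => //; exact: c01.
  have c1s : c1 s = 1 by rewrite /c1 clampi_ge1.
  rewrite c1s; have [pi piP] := stair t t01.
  have g1 : good b (ev u (tau t 1)) (ev v (tau t 1)).
    by apply: (near t) => // c; apply: taun => //; exact: itv01_one.
  have [sb|/ltW sb] := leP (3 * s) 2.
    rewrite /c3 clampi_le0 ?segment0; last by lra.
    by apply: (pP pi) => //; exact: c01.
  have c2s : c2 s = 1 by rewrite /c2 clampi_ge1//; lra.
  rewrite c2s segment1; apply: good_sym; apply: (qP pi) => //; last exact: c01.
  by apply: good_sym; rewrite -[p](segment1 (ev v (tau t 1))); apply: (pP pi) => //; exact: itv01_one.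
- move=> t; rewrite /Ku /Kv /= /c1 /c2 /c3 mulr0 !clampi_le0 ?segment0 ?tau0 ?evc//; lra.
- exists p, q => t; rewrite /Ku /Kv /= /c1 /c2 /c3 mulr1 !clampi_ge1 ?segment1//; lra.
- have tau01 w s : w 0 = w 1 :> coords -> ev w (tau 0 s) = ev w (tau 1 s).
    move=> w01; rewrite (_ : tau 0 s = fun=> 0) 1?(_ : tau 1 s = fun=> 1) ?evc//.
      by apply/funext => c; rewrite /tau phi1 !mulr1 subrK.
    by apply/funext => c; rewrite /tau phi0 !mulr0 addr0.
  by move=> s; rewrite /Ku /Kv /= (tau01 u)// (tau01 v).
Qed.

(* Both points are joined to (q, p) through generic second components. *)
Lemma good_swap_path (b : bool) (x y : coords) : roomy N b -> (0 < d)%N -> good b x y ->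
  exists u v : R -> coords, [/\ coords_cont u, coords_cont v,
    forall t : R, 0 <= t <= 1 -> good b (u t) (v t), u 0 = x /\ v 0 = y & u 1 = y /\ v 1 = x].
Proof.
move=> room d0 g.
pose j0 : 'I_d := Ordinal d0; pose k0 : 'I_(N j0) := Ordinal (ltnW (room.1 j0)).
(* The booleans index two one-point pieces, so that a single apex [p] serves for (x, y) and (y,
   x). *)
have [p pP] := cone (fun _ : bool => cix k0) (fun i : bool => if i then x else y) (fun i : bool => if i then y else x) room.
have [q qP] := cone (fun _ : bool => cix k0) (fun i : bool => p) (fun i : bool => if i then x else y) room.
have g1 s : 0 <= s <= 1 -> good b x (segment s y p) by apply: (pP true).
have g2 s : 0 <= s <= 1 -> good b y (segment s x p) by apply: (pP false) => //; exact: good_sym.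
have h1 s : 0 <= s <= 1 -> good b p (segment s x q).
  by apply: (qP true) => //; apply: good_sym; have := g1 1 itv01_one; rewrite segment1.
have h2 s : 0 <= s <= 1 -> good b p (segment s y q).
  by apply: (qP false) => //; apply: good_sym; have := g2 1 itv01_one; rewrite segment1.
(* One move per quarter of the time: [v] from y to p, [u] from x to q, [u] from q to y, [v] from p
   to x. *)
pose c (k : R) (t : R) := clampi 0 1 (4 * t - k).
pose u (t : R) := segment (c 2 t) (segment (c 1 t) x q) y.
pose v (t : R) := segment (c 3 t) (segment (c 0 t) y p) x.
have cc k : continuous (c k).
  move=> t; apply: (@continuous_comp _ _ _ (fun t : R => 4 * t - k) (clampi 0 1)); last exact: clampi_cont.
  apply: addc_continuous => s; apply: cvgM; [exact: cvg_cst|exact: cvg_id].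
have cseg k w r : coords_cont w -> coords_cont (fun t => segment (c k t) (w t) r).
  move=> cw t j l; have ct := ccont_real (cc k t).
  apply: ccontD; last by apply: ccontM => //; exact: ccont_cst.
  by apply: ccontM => //; apply: ccontB => //; exact: ccont_cst.
have ccst w : coords_cont (fun _ : R => w) by move=> *; exact: ccont_cst.
have c01 k t : 0 <= c k t <= 1 by apply: clampi_itv; exact: ler01.
exists u, v; split;
  [exact: cseg (cseg _ _ _ (ccst x))|exact: cseg (cseg _ _ _ (ccst y))| | |].
- move=> t /andP[t0 t1]; rewrite /u /v.
  have c0 k : 4 * t <= k -> c k t = 0 by move=> h; rewrite /c clampi_le0// subr_le0.
  have c1 k : k + 1 <= 4 * t -> c k t = 1 by move=> h; rewrite /c clampi_ge1// lerBrDr addrC.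
  have [ta|/ltW ta] := leP (4 * t) 1.
    by rewrite (c0 1)// (c0 2) ?(c0 3) ?segment0; [exact: g1|lra..].
  have [tb|/ltW tb] := leP (4 * t) 2.
    rewrite (c0 2)// (c0 3) ?(c1 0) ?segment0 ?segment1; [|lra..].
    by apply: good_sym; exact: h1.
  have [tc|/ltW tc] := leP (4 * t) 3.
    rewrite (c1 1) ?(c0 3) ?(c1 0) ?segment0 ?segment1; [|lra..].
    have -> : segment (c 2 t) q y = segment (1 - c 2 t) y q.
      by apply: coordsP => j k; rewrite /segment rmorphB; ring.
    apply: good_sym; apply: h2; have /andP[] := c01 2 t => *; apply/andP; split; lra.
  rewrite (c1 2) ?(c1 1) ?(c1 0) ?segment1; [|lra..].
  have -> : segment (c 3 t) p x = segment (1 - c 3 t) x p.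
    by apply: coordsP => j k; rewrite /segment rmorphB; ring.
  apply: g2; have /andP[] := c01 3 t => *; apply/andP; split; lra.
- by rewrite /u /v /c mulr0 !clampi_le0 ?segment0//; lra.
- by rewrite /u /v /c mulr1 !clampi_ge1 ?segment1//; lra.
Qed.

End null_homotopy.

(** * Rank-one tensors *)

Section tensor_coordinates.
Context {R : realType} {d : nat} (W : 'I_d -> vectType R[i]).
Local Notation C := R[i].
Local Notation N := (fun j => \dim {: W j}).
Local Notation coords := (@coords R d N).
Local Notation tensor := (tensor W).
Local Notation mi := (multi_index W).

Definition tens (x : coords) : tensor := fun m => \prod_j x j (m j).

Definition coordinates (v : forall j, W j) : coords := fun j k => coord (vbasis {: W j}) k (v j).

Lemma tprodE (v : forall j, W j) : tprod v = tens (coordinates v).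
Proof. by []. Qed.

Lemma coordinates_surj (x : coords) : exists v, coordinates v = x.
Proof.
exists (fun j => \sum_k x j k *: (vbasis {: W j})`_k); apply: coordsP => j k.
by rewrite /coordinates coord_sum_free//; exact: basis_free (vbasisP _).
Qed.

Lemma sum_of_tprodsP r (A : tensor) :
  sum_of_tprods r A <-> exists x : 'I_r -> coords, A = \sum_(k < r) tens (x k).
Proof.
split=> [[v ->]|[x ->]]; first by exists (fun k => coordinates (v k)).
have /choice[v vx] := fun k => coordinates_surj (x k).
by exists v; apply: eq_bigr => k _; rewrite tprodE vx.
Qed.

Definition nonvanishing (x : coords) := forall j, exists k, x j k != 0.

Lemma mi_of (k : forall j, 'I_(\dim {: W j})) : exists m : mi, forall j, m j = k j.
Proof. by exists [ffun j => k j] => j; rewrite ffunE. Qed.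

Lemma tens_neq0 (x : coords) : tens x <> 0 <-> nonvanishing x.
Proof.
split=> [x0 j|x0].
  apply: contrapT => /forallNP h; apply: x0; apply/funext => m; rewrite /tens (bigD1 j)//=.
  by have /negP := h (m j); rewrite negbK => /eqP ->; rewrite mul0r.
have [m mE] := mi_of (fun j => sval (cid (x0 j))).
move=> /(congr1 (fun A : tensor => A m)) /eqP; apply/negP; apply/prodf_neq0 => j _.
by rewrite mE; case: cid.
Qed.

Lemma has_rank1P (A : tensor) : has_rank A 1 <-> exists2 x, nonvanishing x & A = tens x.
Proof.
split=> [[/sum_of_tprodsP[x Ax] Amin]|[x x0 Ax]].
  rewrite big_ord1 in Ax; exists (x ord0) => //; apply/tens_neq0 => x0.
  suff : (1 <= 0)%N by [].
  by apply: Amin; apply/sum_of_tprodsP; exists (fun _ => x ord0); rewrite big_ord0 Ax.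
split; first by apply/sum_of_tprodsP; exists (fun _ => x); rewrite big_ord1.
move=> [|s]// /sum_of_tprodsP[z]; rewrite big_ord0 Ax => h.
by move/tens_neq0: x0; case.
Qed.

Definition set_mi (m : mi) (l : 'I_d) (k : 'I_(\dim {: W l})) : mi :=
  [ffun j => dfwith (fun j => m j) l k j].
Arguments set_mi : clear implicits.

Lemma set_mi_in m l k : set_mi m l k l = k.
Proof. by rewrite ffunE dfwithin. Qed.

Lemma set_mi_out m l k j : j != l -> set_mi m l k j = m j.
Proof. by move=> jl; rewrite ffunE dfwithout// eq_sym. Qed.

Lemma tens_set (z : coords) m l k : tens z (set_mi m l k) * z l (m l) = tens z m * z l k.
Proof.
rewrite /tens (bigD1 l)//= [in RHS](bigD1 l)//= set_mi_in.
rewrite (eq_bigr (fun j => z j (m j))); last by move=> j jl; rewrite set_mi_out.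
by rewrite mulrC mulrA (mulrAC (z l (m l))).
Qed.

Lemma tens_neq0_coord (z : coords) m : tens z m != 0 -> forall l, z l (m l) != 0.
Proof. by move=> /prodf_neq0 h l; exact: h. Qed.

(** Up to a scalar, each factor of a rank-one tensor is a rational function of its entries, hence
    depends continuously on it. *)
Lemma tens_ratio (z : coords) m l k : tens z m != 0 ->
  z l k / z l (m l) = tens z (set_mi m l k) / tens z m.
Proof.
move=> z0; have zl := tens_neq0_coord z0 l.
by apply/eqP; rewrite eqr_div// mulrC -tens_set.
Qed.

Lemma prod_if (J : finType) (l0 : J) (c : C) : \prod_j (if j == l0 then c else 1) = c.
Proof. by rewrite (bigD1 l0)//= eqxx big1 ?mulr1// => j /negbTE ->. Qed.

Lemma ccont_pasting (S : topologicalType) (h : S -> R) (c : R) (f g : S -> C) :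
  continuous h -> (forall s, ccont s f) -> (forall s, ccont s g) ->
  (forall s, h s = c -> f s = g s) -> forall s, ccont s (fun s => if h s <= c then f s else g s).
Proof.
move=> ch cf cg fg s; apply/ccontP.
apply: (@pasting S (C : topologicalType) R h c f g ch) => // {}s; apply/ccontP; [exact: cf|exact: cg].
Qed.

Section rank_one_lifting.
Variable y : R -> tensor.
Hypothesis cy : forall m t, ccont t (fun t => y t m).
Hypothesis y1 : forall t, 0 <= t <= 1 -> has_rank (y t) 1.
Hypothesis d0 : (0 < d)%N.
Let l0 : 'I_d := Ordinal d0.

(** The initial value is prescribed arbitrarily so that lifts over adjacent intervals can be
    joined. *)
Let lifts (a b : R) := forall w0 : coords, tens w0 = y a -> exists w : R -> coords,
  [/\ coords_cont w, w a = w0 & forall t, a <= t <= b -> tens (w t) = y t].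

(* The j-th factor is, up to a scalar, the row of entries through m along j. *)
Let lifts_local x : 0 <= x <= 1 -> exists2 e, 0 < e &
  forall a b, 0 <= a -> a <= b -> b <= 1 -> x - e < a -> b < x + e -> lifts a b.
Proof.
move=> x01; have /has_rank1P[z /tens_neq0 z0 yz] := y1 x01.
have [m ym] : exists m, y x m != 0.
  by apply: contrapT => /forallNP h; apply: z0; apply/funext => m; rewrite -yz;
     have /negP := h m; rewrite negbK => /eqP.
have /nbhs_ballP[e /= e0 eP] := ccont_neq0 (cy m x) ym; exists e => //.
move=> a b a0 ab b1 xa bx w0 w0a.
have near t : y (clampi a b t) m != 0.
  apply: eP; rewrite /ball /= ltr_distlC; have /andP[] := clampi_itv t ab => *.
  by apply/andP; split; lra.
(* The rows are scaled to start at [w0]. Their product then has constant [m]-th entry [y a m], and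
   the factor [l0] is rescaled to correct this. *)
pose w t : coords := fun l k => w0 l (m l) * (y (clampi a b t) (set_mi m l k) / y (clampi a b t) m) *
  (if l == l0 then y (clampi a b t) m / y a m else 1).
have aa : clampi a b a = a by rewrite clampi_id// lexx.
have ya : y a m != 0 by have := near a; rewrite aa.
exists w; split.
- move=> t l k; rewrite /w.
  have cyc n : ccont t (fun t => y (clampi a b t) n).
    apply: (@ccont_comp _ _ _ (clampi a b) (fun t => y t n)); [exact: clampi_cont|exact: cy].
  have cV : ccont t (fun t => (y (clampi a b t) m)^-1) by apply: ccontV.
  apply: ccontM.
    by apply: ccontM; [exact: ccont_cst|apply: ccontM].
  case: (l == l0); last exact: ccont_cst.
  by apply: ccontM => //; exact: ccont_cst.
- apply: coordsP => l k; rewrite /w aa divff// if_same mulr1 -w0a.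
  have w0m : tens w0 m != 0 by rewrite w0a.
  by rewrite -tens_ratio// mulrCA divff ?mulr1//; exact: tens_neq0_coord.
- move=> t /andP[at' tb]; have ct : clampi a b t = t by rewrite clampi_id// at'.
  have /has_rank1P[u _ yu] : has_rank (y t) 1.
    by apply: y1; rewrite (le_trans a0 at') (le_trans tb b1).
  have um : tens u m != 0 by rewrite -yu -ct.
  apply/funext => n; rewrite {1}/tens /w ct !big_split /= prod_if.
  have -> : \prod_j y t (set_mi m j (n j)) * \prod_(j < d) (y t m)^-1 =
      \prod_j (u j (n j) / u j (m j)).
    by rewrite -big_split; apply: eq_bigr => j _ /=; rewrite yu tens_ratio.
  rewrite prodf_div -[\prod_j w0 j (m j)]/(tens w0 m) w0a -/(tens u n) -/(tens u m) yu.
  by field; apply/andP.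
Qed.

Let lifts_glue a b c : a <= b -> b <= c -> lifts a b -> lifts b c -> lifts a c.
Proof.
move=> ab bc l1 l2 w0 w0a; have [w1 [cw1 w1a w1P]] := l1 w0 w0a.
have w1b : tens (w1 b) = y b by apply: w1P; rewrite ab lexx.
have [w2 [cw2 w2b w2P]] := l2 _ w1b.
exists (fun t => if t <= b then w1 t else w2 t); split.
- move=> t j k; have := @ccont_pasting R id b (fun t => w1 t j k) (fun t => w2 t j k) _
    (fun t => cw1 t j k) (fun t => cw2 t j k) _ t.
  move=> h; have {}h : ccont t (fun s => if s <= b then w1 s j k else w2 s j k).
    by apply: h => [s|s ->]; [exact: cvg_id|rewrite w2b].
  by rewrite (_ : (fun _ => _) = (fun s => if s <= b then w1 s j k else w2 s j k))//;
     apply/funext => s; case: ifP.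
- by rewrite ab.
- move=> t /andP[at' tc]; case: (leP t b) => [tb|/ltW bt]; first by apply: w1P; rewrite at'.
  by apply: w2P; rewrite bt.
Qed.

Lemma rank1_path_lift : exists w : R -> coords,
  coords_cont w /\ forall t, 0 <= t <= 1 -> tens (w t) = y t.
Proof.
have l01 : lifts 0 1 by exact: interval_ind lifts_local lifts_glue.
have /has_rank1P[z _ yz] : has_rank (y 0) 1 by apply: y1; rewrite lexx ler01.
by have [w [cw _ wP]] := l01 z (esym yz); exists w.
Qed.

End rank_one_lifting.

(** The segment from 1 to [c] meets 0 only if [c] is a negative real. Adding t (1 - t) times i or
    -i, on the side where the imaginary part of [c] lies, bends it away from 0. *)
Lemma cstar_path (c : C) : c != 0 -> exists e : R -> C,
  [/\ forall t, ccont t e, forall t, e t != 0, e 0 = 1 & e 1 = c].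
Proof.
move=> c0; pose sg : R := if 0 <= complex.Im c then 1 else -1.
pose e0 (t : R) : C := (1 - t%:C) + t%:C * c + (t * (1 - t) * sg)%:C * 'i%C.
exists (fun t => e0 (clampi 0 1 t)); split.
- move=> t; apply: (@ccont_comp _ _ _ (clampi 0 1) e0); first exact: clampi_cont.
  set s := clampi _ _ _; have cs : ccont s (fun t : R => t%:C) by apply: ccont_real; exact: cvg_id.
  rewrite /e0; apply: ccontD.
    apply: ccontD; first by apply: ccontB => //; exact: ccont_cst.
    by apply: ccontM => //; exact: ccont_cst.
  apply: ccontM; last exact: ccont_cst.
  apply: ccont_real; apply: mulc_continuous => r; apply: cvgM; first exact: cvg_id.
  by apply: onem_continuous => ?; exact: cvg_id.
- move=> t; have /andP[t0 t1] := clampi_itv t (@ler01 R); set s := clampi 0 1 t in t0 t1 *.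
  rewrite /e0 /sg; clear e0 sg; case: c c0 => a b c0.
  apply/negP; rewrite eq_complex /= => /andP[/eqP re /eqP im].
  have {}re : 1 - s + s * a = 0 by rewrite -[RHS]re; ring.
  move: im; set q : R := if _ then _ else _ => im.
  have {}im : s * b + s * (1 - s) * q = 0 by rewrite -[RHS]im; ring.
  have {}c0 : a = 0 -> b != 0 by move=> a0; apply: contra c0 => /eqP ->; rewrite a0.
  have s0 : 0 < s.
    by rewrite lt_neqAle t0 andbT; apply/eqP => s0; move: re; rewrite -s0; lra.
  have st : 0 <= s * (1 - s) by rewrite mulr_ge0//; lra.
  have s1 : s = 1.
    move: im; rewrite /q; case: ifPn => [b0|]; last rewrite -ltNge => b0; nra.
  move: re im; rewrite s1 => re im; have a0 : a = 0 by lra.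
  by have := c0 a0; rewrite (_ : b = 0) ?eqxx//; lra.
- by rewrite clampi_id ?lexx ?ler01// /e0 mul0r mul0r subr0 !mul0r !addr0.
- by rewrite clampi_id ?lexx ?ler01// /e0 !subrr mulr0 !mul0r mul1r addr0 add0r.
Qed.

(* The end points of a lift differ by scalars with product 1, which are removed
   along paths of nonzero scalars with product 1. *)
Lemma rank1_loop_lift (y : R -> tensor) : (0 < d)%N ->
  (forall m t, ccont t (fun t => y t m)) -> (forall t, 0 <= t <= 1 -> has_rank (y t) 1) ->
  y 0 = y 1 -> exists w : R -> coords,
    [/\ coords_cont w, forall t, 0 <= t <= 1 -> tens (w t) = y t & w 0 = w 1].
Proof.
move=> d0 cy y1 y01; have [w [cw wy]] := rank1_path_lift cy y1 d0.
pose l0 : 'I_d := Ordinal d0.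
have i0 : 0 <= (0 : R) <= 1 by rewrite lexx ler01.
have i1 : 0 <= (1 : R) <= 1 by exact: itv01_one.
have /has_rank1P[z /tens_neq0 z0 yz] := y1 _ i0.
have [m ym] : exists m, y 0 m != 0.
  by apply: contrapT => /forallNP h; apply: z0; apply/funext => m; rewrite -yz;
     have /negP := h m; rewrite negbK => /eqP.
have w0m : tens (w 0) m != 0 by rewrite wy.
have w1m : tens (w 1) m != 0 by rewrite wy// -y01.
have w0l := tens_neq0_coord w0m; have w1l := tens_neq0_coord w1m.
pose c l := w 1 l (m l) / w 0 l (m l).
have c0 l : c l != 0 by rewrite mulf_neq0// invr_eq0.
have wc l k : w 1 l k = c l * w 0 l k.
  have : w 1 l k / w 1 l (m l) = w 0 l k / w 0 l (m l) by rewrite !tens_ratio// !wy// y01.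
  move=> h; rewrite -[LHS](divfK (w1l l)) h /c; field; exact: w0l.
have cprod : \prod_l c l = 1.
  by rewrite prodf_div -/(tens (w 1) m) -/(tens (w 0) m) !wy// -y01 divff.
have /choice[k kP] := fun l => cstar_path (c0 l).
(* The factor [l0] compensates the others, so the product is 1 at every time; at time 1 it equals
   [c l0] because the product of all [c l] is 1. *)
pose e l t := if l == l0 then (\prod_(j | j != l0) k j t)^-1 else k l t.
have prodk t : \prod_(j | j != l0) k j t != 0 by apply/prodf_neq0 => j _; case: (kP j).
have e0 l t : e l t != 0.
  by rewrite /e; case: ifP => _; [rewrite invr_eq0|case: (kP l)].
have eprod t : \prod_l e l t = 1.
  rewrite (bigD1 l0)//= {1}/e eqxx (eq_bigr (fun l => k l t)) ?mulVf//.
  by move=> l /negbTE ll; rewrite /e ll.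
have ce l t : ccont t (e l).
  rewrite /e; case: (l == l0); last by case: (kP l).
  apply: ccontV => //; rewrite (_ : (fun _ => _) = fun t => \prod_j (if j != l0 then k j t else 1)).
    by apply: ccont_prod => j; case: (j != l0); [case: (kP j)|exact: ccont_cst].
  by apply/funext => s; rewrite big_mkcond.
have ee0 l : e l 0 = 1.
  rewrite /e; case: ifP => _; last by case: (kP l).
  by rewrite big1 ?invr1// => j _; case: (kP j).
have ee1 l : e l 1 = c l.
  rewrite /e; case: eqP => [->|_]; last by case: (kP l).
  rewrite (eq_bigr c); last by move=> j _; case: (kP j).
  move: cprod; rewrite (bigD1 l0)//= => cp.
  by apply: (mulIf (_ : \prod_(j | j != l0) c j != 0)); rewrite ?cp ?mulVf//;
     apply/prodf_neq0.
exists (fun t => fun l k => w t l k / e l t); split.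
- move=> t l n; apply: ccontM; first exact: cw.
  by apply: ccontV.
- move=> t t01; apply/funext => n; rewrite /tens prodf_div eprod divr1.
  by rewrite -[LHS]/(tens (w t) n) wy.
- apply: coordsP => l n; rewrite ee0 ee1 divr1 wc; field; exact: c0.
Qed.

End tensor_coordinates.

(** * Continuity of the components *)

Section contraction.
Context {R : realType} {d : nat} (W : 'I_d -> vectType R[i]).
Local Notation C := R[i].
Local Notation N := (fun j => \dim {: W j}).
Local Notation coords := (@coords R d N).
Local Notation tensor := (tensor W).
Local Notation mi := (multi_index W).

Arguments coordinates {R d W} v j k.

Definition dot (n : nat) (f w : 'I_n -> C) : C := \sum_k f k * w k.

Definition ctr (h : coords) (A : tensor) : C := \sum_m A m * \prod_l h l (m l).

Lemma ctrP h (a : C) (A B : tensor) : ctr h (a *: A + B) = a * ctr h A + ctr h B.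
Proof.
rewrite /ctr mulr_sumr -big_split; apply: eq_bigr => m _ /=.
by rewrite (_ : (a *: A + B) m = a * A m + B m)// mulrDl mulrA.
Qed.

Lemma ctrD h (A B : tensor) : ctr h (A + B) = ctr h A + ctr h B.
Proof. by rewrite -[A in LHS]scale1r ctrP mul1r. Qed.

(** Both sides are multilinear in the tuple, so by [multilinear_eq] it is enough to compare them on
    basis vectors. *)
Lemma ctr_tens (h x : coords) : ctr h (tens (W := W) x) = \prod_l dot (h l) (x l).
Proof.
pose g (v : forall j, W j) : C^o := \prod_l dot (h l) (coordinates v l).
have gl : multilinear g.
  move=> v j a y z.
  have E (w : W j) : g (dfwith v j w) = dot (h j) (fun k => coord (vbasis {: W j}) k w) *
      \prod_(l | l != j) dot (h l) (coordinates v l).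
    rewrite /g (bigD1 j)//= /coordinates dfwithin; congr (_ * _).
    by apply: eq_bigr => l lj; rewrite dfwithout// eq_sym.
  rewrite !E -[X in _ = X + _]/(a * (_ * _)) mulrA -mulrDl; congr (_ * _).
  rewrite /dot [a * _]mulr_sumr -big_split; apply: eq_bigr => k _ /=.
  by rewrite linearP /= mulrDr mulrCA.
have cl : multilinear (fun v : forall j, W j => ctr h (tprod v) : C^o).
  by move=> v j a y z; rewrite tprod_multilinear ctrP.
have [v <-] := coordinates_surj x; rewrite -tprodE.
apply: (multilinear_eq cl gl) => m.
have mm : ctr h (tprod (basis_vectors m)) = \prod_l h l (m l).
  rewrite /ctr (bigD1 m)//= tprod_basis eqxx mul1r [X in _ + X]big1 ?addr0// => m' mm'.
  by rewrite tprod_basis (negbTE mm') mul0r.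
rewrite [LHS]mm; apply: eq_bigr => l _; rewrite /dot (bigD1 (m l))//= big1 => [|k kl].
  by rewrite /coordinates coord_free ?eqxx ?mulr1 ?addr0//; exact: basis_free (vbasisP _).
rewrite /coordinates coord_free; last exact: basis_free (vbasisP _).
by rewrite eq_sym (negbTE kl) mulr0.
Qed.

Lemma ccont_ctr (S : topologicalType) (f : S -> tensor) s h :
  (forall m, ccont s (fun x => f x m)) -> ccont s (fun x => ctr h (f x)).
Proof.
by move=> cf; apply: ccont_sum => m; apply: ccontM; [exact: cf|exact: ccont_cst].
Qed.

Lemma dual_pair n (u v : 'I_n -> C) x y : u x * v y != u y * v x ->
  exists f g, [/\ dot f u = 1, dot f v = 0, dot g u = 0 & dot g v = 1].
Proof.
move=> uv; have D0 : u x * v y - u y * v x != 0 by rewrite subr_eq0.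
have xy : x != y by apply: contraNneq uv => ->; rewrite mulrC.
pose h (a b : C) (k : 'I_n) : C := (if k == x then a else if k == y then b else 0) / (u x * v y - u y * v x).
have hE a b w : dot (h a b) w = (a * w x + b * w y) / (u x * v y - u y * v x).
  rewrite /dot (bigD1 x)//= (bigD1 y) ?(eq_sym y)//= big1; last first.
    by move=> k /andP[/negbTE kx /negbTE ky]; rewrite /h kx ky !mul0r.
  by rewrite /h eqxx eq_sym (negbTE xy) eqxx; field.
by exists (h (v y) (- v x)), (h (- u y) (u x)); rewrite !hE; split; field.
Qed.

(** A space is not the union of two hyperplanes: one of two coordinate functionals works, or else
    their sum. *)
Lemma dot_nonzero2 n (u v : 'I_n -> C) : (exists k, u k != 0) -> (exists k, v k != 0) ->
  exists f, dot f u != 0 /\ dot f v != 0.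
Proof.
move=> [x ux] [y vy].
have dE (z : 'I_n) w : dot (fun k => (k == z)%:R) w = w z.
  rewrite /dot (bigD1 z)//= eqxx mul1r big1 ?addr0// => k /negbTE ->.
  by rewrite mul0r.
have [vx|vx] := eqVneq (v x) 0; last by exists (fun k => (k == x)%:R); rewrite !dE.
have [uy|uy] := eqVneq (u y) 0; last by exists (fun k => (k == y)%:R); rewrite !dE.
exists (fun k => (k == x)%:R + (k == y)%:R).
have sE w : dot (fun k => (k == x)%:R + (k == y)%:R) w = w x + w y.
  by rewrite -[in RHS](dE x) -[in RHS](dE y) /dot -big_split; apply: eq_bigr => k _; rewrite mulrDl.
by rewrite !sE vx uy addr0 add0r.
Qed.

Lemma ccont_squeeze (S : topologicalType) (f g : S -> C) s :
  (\forall x \near s, `|f x| <= `|g x|) -> ccont s g -> g s = 0 -> ccont s f.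
Proof.
move=> fg [cg] gs; have fs : f s = 0.
  have := nbhs_singleton fg; rewrite gs normr0 normr_le0 => /eqP //.
constructor; apply/(@cvgrPdist_lt (R[i] : numFieldType) (R[i] : normedModType R[i])) => e e0.
have /(@cvgrPdist_lt (R[i] : numFieldType) (R[i] : normedModType R[i]))/(_ e e0) := cg.
apply: filterS2 fg => x fgx; rewrite fs gs !sub0r !normrN => ge.
exact: le_lt_trans fgx ge.
Qed.

(** * Recovering a component from contractions at three factors *)

Section three_indices.
Variables (i j k : 'I_d) (F G : coords).
Arguments F : clear implicits.
Arguments G : clear implicits.
Hypotheses (ij : i != j) (ik : i != k) (jk : j != k).

(** For fixed [a], the four values of [(be, ga)] give the 2x2 matrix of A contracted with [a] at [i]
    and with [F] outside the three indices, read in the frame [F], [G] at [j] and [k]. *)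
Definition functional (a : 'I_(\dim {: W i}) -> C) (be ga : bool) : coords :=
  fun l => if l == j then (if be then G l else F l)
           else if l == k then (if ga then G l else F l) else dfwith F i a l.
Arguments functional : clear implicits.

Definition ctr3 a be ga (A : tensor) := ctr (functional a be ga) A.

Definition off3 (w : coords) := \prod_(l | [&& l != i, l != j & l != k]) dot (F l) (w l).

Lemma ctr3_tens a be ga w : ctr3 a be ga (tens (W := W) w) =
  dot a (w i) * dot (if be then G j else F j) (w j) * dot (if ga then G k else F k) (w k) * off3 w.
Proof.
rewrite /ctr3 ctr_tens (bigD1 i)//= (bigD1 j) ?(eq_sym j)//= (bigD1 k) ?(eq_sym k) ?ik ?jk//=.
rewrite /functional (negbTE ij) (negbTE ik) dfwithin eqxx (eq_sym k j) (negbTE jk) eqxx.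
rewrite -!mulrA; congr (_ * (_ * (_ * _))); rewrite /off3.
apply: eq_big => [l|l /andP[/andP[li lj] lk]]; first by rewrite andbA.
by rewrite (negbTE lj) (negbTE lk) dfwithout// eq_sym.
Qed.

Lemma ctr3_sum a be ga x y : ctr3 a be ga (tens (W := W) x + tens y) =
  dot a (x i) * dot (if be then G j else F j) (x j) * dot (if ga then G k else F k) (x k) * off3 x +
  dot a (y i) * dot (if be then G j else F j) (y j) * dot (if ga then G k else F k) (y k) * off3 y.
Proof. by rewrite /ctr3 ctrD -!/(ctr3 _ _ _ _) !ctr3_tens. Qed.

(* The coefficients of the quadratic polynomial
   det (M_F - mu M_G) = det_F - mu det_FG + mu^2 det_G
   in the 2x2 matrices of contractions along i. *)
Definition det_F A := ctr3 (F i) false false A * ctr3 (F i) true true A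
  - ctr3 (F i) false true A * ctr3 (F i) true false A.
Definition det_G A := ctr3 (G i) false false A * ctr3 (G i) true true A
  - ctr3 (G i) false true A * ctr3 (G i) true false A.
Definition det_FG A := ctr3 (F i) false false A * ctr3 (G i) true true A
  + ctr3 (G i) false false A * ctr3 (F i) true true A
  - ctr3 (F i) false true A * ctr3 (G i) true false A
  - ctr3 (G i) false true A * ctr3 (F i) true false A.

Definition delta (n : nat) (z k : 'I_n) : C := (k == z)%:R.

Lemma dot_delta n (z : 'I_n) w : dot (delta z) w = w z.
Proof.
rewrite /dot (bigD1 z)//= /delta eqxx mul1r big1 ?addr0// => l /negbTE ->.
by rewrite mul0r.
Qed.

(* If F - mu G kills y_i and G - nu F kills x_i, then the component tens x of
   A = tens x + tens y is form_num / form_den. *)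
Definition form_den mu nu A :=
  (ctr3 (G i) true true A - nu * ctr3 (F i) true true A) *
  (ctr3 (F i) false false A - mu * ctr3 (G i) false false A) -
  (ctr3 (G i) false false A - nu * ctr3 (F i) false false A) *
  (ctr3 (F i) true true A - mu * ctr3 (G i) true true A).

Definition form_num mu nu (A : tensor) (n : mi) :=
  ((ctr3 (G i) true true A - nu * ctr3 (F i) true true A) * ctr3 (delta (n i)) false false A -
   (ctr3 (G i) false false A - nu * ctr3 (F i) false false A) * ctr3 (delta (n i)) true true A) *
  \sum_l (F i l - mu * G i l) * A (set_mi n l).

(** Contractions with G - nu F at [i] see only [y]. They are the weights with which the y-parts of
    the two [delta] contractions cancel, so the bracket is a multiple of the [i]-th factor of [x].
    The sum over [l] contracts with F - mu G, sees only [x] and supplies its other factors. The same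
    multiple appears in [form_den]. *)
Lemma form_component mu nu x y n : dot (G i) (x i) = nu * dot (F i) (x i) ->
  dot (F i) (y i) = mu * dot (G i) (y i) ->
  form_num mu nu (tens (W := W) x + tens y) n =
  tens x n * form_den mu nu (tens (W := W) x + tens y).
Proof.
move=> Gx Fy; rewrite /form_num /form_den !ctr3_sum !dot_delta Gx Fy.
have slice (w : coords) l : tens (W := W) w (set_mi n l) = w i l * \prod_(j | j != i) w j (n j).
  rewrite /tens (bigD1 i)//= set_mi_in; congr (_ * _).
  by apply: eq_bigr => l' li; rewrite set_mi_out.
have -> : \sum_l (F i l - mu * G i l) * (tens (W := W) x + tens y) (set_mi n l) =
    (dot (F i) (x i) - mu * dot (G i) (x i)) * \prod_(j | j != i) x j (n j) +
    (dot (F i) (y i) - mu * dot (G i) (y i)) * \prod_(j | j != i) y j (n j).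
  rewrite /dot !mulr_sumr -!sumrB !mulr_suml -big_split; apply: eq_bigr => l _ /=.
  rewrite (_ : (tens (W := W) x + tens y) (set_mi n l) = tens x (set_mi n l) + tens y (set_mi n l))//.
  by rewrite !slice; ring.
rewrite Gx Fy (_ : tens x n = x i (n i) * \prod_(j | j != i) x j (n j)); last by rewrite /tens (bigD1 i).
by ring.
Qed.

Lemma labelled_component A x y : A = tens (W := W) x + tens y -> det_FG A != 0 ->
  `|dot (G i) (x i) * dot (F i) (y i)| <= `|dot (F i) (x i) * dot (G i) (y i)| ->
  exists mu nu, [/\ `|mu| <= `|2 * det_F A / det_FG A|, `|nu| <= `|2 * det_G A / det_FG A| &
    forall n, form_num mu nu A n = tens x n * form_den mu nu A].
Proof.
set p := dot (F i) (x i); set q := dot (G i) (x i); set r := dot (F i) (y i); set s := dot (G i) (y i).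
move=> AE.
pose K := off3 x * off3 y *
  (dot (F j) (x j) * dot (G j) (y j) - dot (G j) (x j) * dot (F j) (y j)) *
  (dot (F k) (x k) * dot (G k) (y k) - dot (G k) (x k) * dot (F k) (y k)).
have c0E : det_F A = p * r * K by rewrite /det_F AE !ctr3_sum -/p -/q -/r -/s /K; ring.
have c2E : det_G A = q * s * K by rewrite /det_G AE !ctr3_sum -/p -/q -/r -/s /K; ring.
have mE : det_FG A = (p * s + q * r) * K by rewrite /det_FG AE !ctr3_sum -/p -/q -/r -/s /K; ring.
rewrite c0E c2E mE => m0 qrps.
have K0 : K != 0 by apply: contraNneq m0 => ->; rewrite mulr0.
have psqr : p * s + q * r != 0 by apply: contraNneq m0 => ->; rewrite mul0r.
have ps0 : p * s != 0.
  apply: contraNneq psqr => ps; move: qrps; rewrite ps normr0 normr_le0 => /eqP ->.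
  by rewrite addr0.
have p0 : p != 0 by apply: contraNneq ps0 => ->; rewrite mul0r.
have s0 : s != 0 by apply: contraNneq ps0 => ->; rewrite mulr0.
have bound : `|p * s + q * r| <= 2 * `|p * s|.
  by rewrite mulr_natl mulr2n (le_trans (ler_normD _ _))// lerD2l.
have small z : `|z| / `|p * s| <= `|2 * z / (p * s + q * r)|.
  have -> : `|2 * z / (p * s + q * r)| = 2 * `|z| / `|p * s + q * r|.
    by rewrite normrM normrM normfV ger0_norm// ler0n.
  rewrite ler_pdivrMr ?normr_gt0// mulrAC ler_pdivlMr ?normr_gt0//.
  by rewrite (mulrC 2) -mulrA ler_wpM2l.
have canc z : 2 * (z * K) / ((p * s + q * r) * K) = 2 * z / (p * s + q * r).
  by rewrite mulrA -mulf_div divff// mulr1.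
exists (r / s), (q / p); split.
- rewrite canc (le_trans _ (small (p * r)))// -normfV -normrM.
  by rewrite -mulf_div divff// mul1r.
- rewrite canc (le_trans _ (small (q * s)))// -normfV -normrM.
  by rewrite -mulf_div (divff s0) mulr1.
- by move=> n; rewrite AE; apply: form_component; rewrite divfK.
Qed.

Lemma det_FG_rank1 x y : (forall l, y i l = 0) -> det_FG (tens (W := W) x + tens y) = 0.
Proof.
move=> y0; have dy f : dot f (y i) = 0 by rewrite /dot big1// => l _; rewrite y0 mulr0.
by rewrite /det_FG !ctr3_sum !dy; ring.
Qed.

Lemma ccont_ctr3 (S : topologicalType) (f : S -> tensor) s a be ga :
  (forall m, ccont s (fun x => f x m)) -> ccont s (fun x => ctr3 a be ga (f x)).
Proof. exact: ccont_ctr. Qed.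

End three_indices.

Definition three_independent (u v : coords) := exists i j k,
  [/\ i != j, i != k, j != k & [/\ indep_at i u v, indep_at j u v & indep_at k u v]].

Lemma good_three (u v : coords) : (0 < d)%N -> good true u v -> three_independent u v.
Proof.
move=> d0 [_ _ /(_ isT) uv].
have [i [_ _ iuv]] := uv (Ordinal d0) (Ordinal d0).
have [j [ji _ juv]] := uv i i.
have [k [ki kj kuv]] := uv i j.
by exists i, j, k; split=> //; rewrite eq_sym.
Qed.

Lemma dual_frame (u v : coords) i j k : nonvanishing u -> nonvanishing v ->
  indep_at i u v -> indep_at j u v -> indep_at k u v -> exists F G : coords,
  (forall l, l \in [:: i; j; k] -> [/\ dot (F l) (u l) = 1, dot (F l) (v l) = 0,
     dot (G l) (u l) = 0 & dot (G l) (v l) = 1]) /\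
  forall l, dot (F l) (u l) != 0 /\ (l \notin [:: i; j; k] -> dot (F l) (v l) != 0).
Proof.
move=> u0 v0 iuv juv kuv.
have h l : exists FG : ('I_(\dim {: W l}) -> C) * ('I_(\dim {: W l}) -> C),
   (l \in [:: i; j; k] -> [/\ dot FG.1 (u l) = 1, dot FG.1 (v l) = 0,
     dot FG.2 (u l) = 0 & dot FG.2 (v l) = 1]) /\
   (dot FG.1 (u l) != 0 /\ (l \notin [:: i; j; k] -> dot FG.1 (v l) != 0)).
  have [lin|lout] := boolP (l \in _).
    have [x [y xy]] : indep_at l u v by move: lin; rewrite !inE => /or3P[]/eqP ->.
    have [f [g [fu fv gu gv]]] := dual_pair xy.
    by exists (f, g); split=> //=; rewrite fu oner_neq0.
  have [f [fu fv]] := dot_nonzero2 (u0 l) (v0 l).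
  by exists (f, f).
exists (fun l => (sval (cid (h l))).1), (fun l => (sval (cid (h l))).2).
split=> l; first by move=> li; case: cid => FG /= [+ _]; exact.
by case: cid => FG /= [_].
Qed.

Section frame.
Variables (u v : coords) (i j k : 'I_d) (F G : coords).
Arguments F : clear implicits.
Arguments G : clear implicits.
Arguments u : clear implicits.
Arguments v : clear implicits.
Hypotheses (ij : i != j) (ik : i != k) (jk : j != k).
Hypothesis FG : forall l, l \in [:: i; j; k] -> [/\ dot (F l) (u l) = 1, dot (F l) (v l) = 0,
     dot (G l) (u l) = 0 & dot (G l) (v l) = 1].
Hypothesis F0 : forall l, dot (F l) (u l) != 0 /\ (l \notin [:: i; j; k] -> dot (F l) (v l) != 0).
Let A0 : tensor := tens u + tens v.

Let off_u : off3 i j k F u != 0.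
Proof. by apply/prodf_neq0 => l _; case: (F0 l). Qed.
Let off_v : off3 i j k F v != 0.
Proof.
apply/prodf_neq0 => l /and3P[li lj lk]; have [_] := F0 l; apply.
by rewrite !inE !negb_or li lj.
Qed.

Let frameE := (ctr3_sum F G ij ik jk).

(** In the dual frame the two matrices at the centre are diag(off3 u, 0) for F and diag(0, off3 v)
    for G: the roots are 0 and infinity, so mu = nu = 0. *)
Lemma frame_dets : [/\ det_F i j k F G A0 = 0, det_G i j k F G A0 = 0,
  det_FG i j k F G A0 != 0 & form_den i j k F G 0 0 A0 != 0].
Proof.
have [|Fui Fvi Gui Gvi] := FG (l := i); first by rewrite inE eqxx.
have [|Fuj Fvj Guj Gvj] := FG (l := j); first by rewrite !inE eqxx orbT.
have [|Fuk Fvk Guk Gvk] := FG (l := k); first by rewrite !inE eqxx !orbT.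
rewrite /det_F /det_G /det_FG /form_den !frameE Fui Fvi Gui Gvi Fuj Fvj Guj Gvj Fuk Fvk Guk Gvk.
split; [by ring|by ring| |].
  rewrite (_ : _ - _ = off3 i j k F u * off3 i j k F v); last by ring.
  by rewrite mulf_neq0.
rewrite (_ : _ - _ = off3 i j k F u * off3 i j k F v); last by ring.
by rewrite mulf_neq0.
Qed.

Lemma frame_num n : form_num i j k F G 0 0 A0 n = tens (W := W) u n * form_den i j k F G 0 0 A0.
Proof.
have [|Fui Fvi Gui Gvi] := FG (l := i); first by rewrite inE eqxx.
by apply: (form_component ij ik jk); rewrite ?Gui ?Fvi mul0r.
Qed.

End frame.

Lemma order_components i (F G x y : coords) :
  exists x' y', [/\ tens (W := W) x' + tens y' = tens x + tens y, (x' = x \/ x' = y) &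
  `|dot (G i) (x' i) * dot (F i) (y' i)| <= `|dot (F i) (x' i) * dot (G i) (y' i)|].
Proof.
have /orP[h|h] := real_leVge (normr_real (dot (G i) (x i) * dot (F i) (y i)))
  (normr_real (dot (F i) (x i) * dot (G i) (y i))).
  by exists x, y; split=> //; left.
exists y, x; split; [by rewrite addrC|by right|].
by rewrite mulrC [leRHS](_ : _ = `|dot (G i) (x i) * dot (F i) (y i)|) // mulrC.
Qed.

(** In a frame dual to u, v the bounds force mu = nu = 0 for the suitably ordered second
    decomposition as well, so the same quotient computes one of its components and [tens u]. *)
Lemma good_unique (u v x y : coords) : (0 < d)%N -> good true u v ->
  tens (W := W) u + tens v = tens x + tens y -> tens (W := W) u = tens x \/ tens (W := W) u = tens y.
Proof.
move=> d0 g E; have [i [j [k [ij ik jk [iuv juv kuv]]]]] := good_three d0 g.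
have [u0 v0 _] := g; have [F [G [FG F0]]] := dual_frame u0 v0 iuv juv kuv.
have [dF dG dFG den] := frame_dets ij ik jk FG F0.
have [x' [y' [E' xx' le]]] := order_components i F G x y.
have AE : tens (W := W) u + tens v = tens x' + tens y' by rewrite E E'.
have [mu [nu [mu0 nu0 num]]] := labelled_component ij ik jk AE dFG le.
move: mu0 nu0; rewrite dF dG mulr0 mul0r normr0 !normr_le0 => /eqP mu0 /eqP nu0.
have ux : tens (W := W) u = tens x'.
  apply/funext => n; apply: (mulIf den).
  by rewrite -(frame_num ij ik jk FG); move: (num n); rewrite mu0 nu0.
by rewrite ux; case: xx' => ->; [left|right].
Qed.

(** [det_FG] is nonzero on the sum in a frame dual to u, v, but vanishes on tensors of rank at most
    one. *)
Lemma good_rank_gt1 (u v x : coords) : (0 < d)%N -> good true u v ->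
  tens (W := W) u + tens v <> tens x.
Proof.
move=> d0 g E; have [i [j [k [ij ik jk [iuv juv kuv]]]]] := good_three d0 g.
have [u0 v0 _] := g; have [F [G [FG F0]]] := dual_frame u0 v0 iuv juv kuv.
have [_ _ + _] := frame_dets ij ik jk FG F0; rewrite E.
have -> : tens (W := W) x = tens x + tens (fun _ _ => 0).
  suff -> : tens (W := W) (fun _ _ => 0) = 0 by rewrite addr0.
  by apply/funext => m; rewrite /tens (bigD1 (Ordinal d0))//= mul0r.
by rewrite det_FG_rank1 ?eqxx.
Qed.

(** The frame is adapted to [f s], where mu and nu vanish. However they are chosen elsewhere, the
    bounds squeeze them to 0 at [s], and the quotient formula passes continuity at [s] on to the
    component. *)
Lemma component_continuous (S : topologicalType) (f : S -> tensor) (s : S) (u v : coords) :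
  (0 < d)%N -> good true u v -> f s = tens u + tens v ->
  (forall m, ccont s (fun x => f x m)) -> (forall x, exists a b, f x = tens a + tens b) ->
  exists a b : S -> coords, [/\ forall x, f x = tens (a x) + tens (b x),
    tens (a s) = tens (W := W) u & forall m, ccont s (fun x => tens (W := W) (a x) m)].
Proof.
move=> d0 g fs cf fab; have [i [j [k [ij ik jk [iuv juv kuv]]]]] := good_three d0 g.
have [u0 v0 _] := g; have [F [G [FG F0]]] := dual_frame u0 v0 iuv juv kuv.
have [dF dG dFG den] := frame_dets ij ik jk FG F0.
have num0 := frame_num ij ik jk FG.
rewrite -fs in dF dG dFG den num0.
have ex x : exists ab : coords * coords, f x = tens ab.1 + tens ab.2 /\
   `|dot (G i) (ab.1 i) * dot (F i) (ab.2 i)| <= `|dot (F i) (ab.1 i) * dot (G i) (ab.2 i)|.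
  have [a [b fxab]] := fab x; have [a' [b' [E _ le]]] := order_components i F G a b.
  by exists (a', b'); rewrite fxab E.
have /choice[ab abP] := ex.
have ex2 x : exists mn : C * C, det_FG i j k F G (f x) != 0 ->
  [/\ `|mn.1| <= `|2 * det_F i j k F G (f x) / det_FG i j k F G (f x)|,
      `|mn.2| <= `|2 * det_G i j k F G (f x) / det_FG i j k F G (f x)| &
    forall n, form_num i j k F G mn.1 mn.2 (f x) n =
      tens (ab x).1 n * form_den i j k F G mn.1 mn.2 (f x)].
  have [h0|h0] := eqVneq (det_FG i j k F G (f x)) 0; first by exists (0, 0).
  have [fx le] := abP x.
  by have [mu [nu [h1 h2 h3]]] := labelled_component ij ik jk fx h0 le; exists (mu, nu).
have /choice[mn mnP] := ex2.
have cT a be ga : ccont s (fun x => ctr3 j k F G (i := i) a be ga (f x)) by exact: ccont_ctr3.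
have cdF : ccont s (fun x => det_F i j k F G (f x)).
  by apply: ccontB; apply: ccontM; exact: cT.
have cdG : ccont s (fun x => det_G i j k F G (f x)).
  by apply: ccontB; apply: ccontM; exact: cT.
have cdFG : ccont s (fun x => det_FG i j k F G (f x)).
  apply: ccontB; last by apply: ccontM; exact: cT.
  apply: ccontB; last by apply: ccontM; exact: cT.
  by apply: ccontD; apply: ccontM; exact: cT.
have nFG := ccont_neq0 cdFG dFG.
have cmu : ccont s (fun x => (mn x).1).
  apply: (@ccont_squeeze _ _ (fun x => 2 * det_F i j k F G (f x) / det_FG i j k F G (f x))).
  - by apply: filterS nFG => x /mnP[].
  - apply: ccontM; last exact: ccontV.
    by apply: ccontM => //; exact: ccont_cst.
  - by rewrite dF mulr0 mul0r.
have cnu : ccont s (fun x => (mn x).2).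
  apply: (@ccont_squeeze _ _ (fun x => 2 * det_G i j k F G (f x) / det_FG i j k F G (f x))).
  - by apply: filterS nFG => x /mnP[].
  - apply: ccontM; last exact: ccontV.
    by apply: ccontM => //; exact: ccont_cst.
  - by rewrite dG mulr0 mul0r.
have mn0 : (mn s).1 = 0 /\ (mn s).2 = 0.
  have [+ + _] := mnP s dFG; rewrite dF dG mulr0 mul0r normr0 !normr_le0.
  by move=> /eqP -> /eqP ->.
have cden : ccont s (fun x => form_den i j k F G (mn x).1 (mn x).2 (f x)).
  by apply: ccontB; apply: ccontM; apply: ccontB; (exact: cT) || (apply: ccontM; [|exact: cT]).
have dens : form_den i j k F G (mn s).1 (mn s).2 (f s) != 0 by case: mn0 => -> ->.
have nden := ccont_neq0 cden dens.
exists (fun x => (ab x).1), (fun x => (ab x).2); split.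
- by move=> x; case: (abP x).
- apply/funext => n; apply: (mulIf dens); have [_ _ <-] := mnP s dFG.
  by case: mn0 => -> ->; rewrite num0.
move=> m.
have cquo : ccont s (fun x => form_num i j k F G (mn x).1 (mn x).2 (f x) m /
    form_den i j k F G (mn x).1 (mn x).2 (f x)).
  apply: ccontM; last exact: ccontV.
  apply: ccontM.
    by apply: ccontB; apply: ccontM; (exact: cT) || (apply: ccontB; (exact: cT) || (apply: ccontM; [|exact: cT])).
  apply: ccont_sum => l; apply: ccontM; last exact: cf.
  by apply: ccontB; [exact: ccont_cst|apply: ccontM => //; exact: ccont_cst].
have E : \forall x \near s, form_num i j k F G (mn x).1 (mn x).2 (f x) m /
    form_den i j k F G (mn x).1 (mn x).2 (f x) = tens (ab x).1 m.
  apply: filterS2 nFG nden => x /mnP[_ _ h] dx; rewrite h mulfK//.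
exact: ccont_near_eq E cquo.
Qed.

End contraction.

(** * Rank-two tensors *)

Section rank_two.
Context {R : realType} {d : nat} (W : 'I_d -> vectType R[i]).
Local Notation C := R[i].
Local Notation N := (fun j => \dim {: W j}).
Local Notation coords := (@coords R d N).
Local Notation tensor := (tensor W).
Local Notation I := (unit_interval R).

Definition rank_one : set tensor := [set A : tensor | has_rank A 1].
Definition rank_two : set tensor := [set A : tensor | has_rank A 2 /\ identifiable A].

Lemma tensor_eq (A B : tensor) : (forall m, A m = B m) -> A = B.
Proof. by move=> h; apply/funext. Qed.

Lemma tensor_continuous_at (S : topologicalType) (f : S -> tensor) s :
  (forall m, ccont s (fun x => f x m)) -> {for s, continuous f}.
Proof. by move=> cf; apply: tensor_cvg => m; have [] := cf m. Qed.

Lemma tensor_continuous (S : topologicalType) (f : S -> tensor) :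
  (forall m s, ccont s (fun x => f x m)) -> continuous f.
Proof. by move=> cf s; apply: tensor_continuous_at => m; exact: cf. Qed.

Lemma tensor_coord_ccont (S : topologicalType) (f : S -> tensor) m s :
  continuous f -> ccont s (fun x => f x m).
Proof.
move=> cf; constructor; apply: (@continuous_comp _ _ (C : topologicalType) f (fun A : tensor => A m)).
  exact: cf.
exact: tensor_coord_cont.
Qed.

Lemma tensor_hausdorff : hausdorff_space tensor.
Proof.
move=> A B AB; apply: tensor_eq => m.
have hC : hausdorff_space (C : topologicalType).
  exact: (@norm_hausdorff (R[i] : numFieldType) (R[i] : normedModType R[i])).
apply: hC => U V UA VB.
have [D [UD VD]] := AB _ _ (tensor_coord_cont UA) (tensor_coord_cont VB).
by exists (D m).
Qed.

Lemma ccont_tens (S : topologicalType) (u : S -> coords) m s :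
  coords_cont u -> ccont s (fun x => tens (W := W) (u x) m).
Proof. by move=> cu; apply: ccont_prod => j; exact: cu. Qed.

Lemma tens_zero : (0 < d)%N -> tens (W := W) (fun _ _ => 0) = 0.
Proof. by move=> d0; apply: tensor_eq => m; rewrite /tens (bigD1 (Ordinal d0))//= mul0r. Qed.

Lemma rank2_sum (A : tensor) : has_rank A 2 -> exists u v, A = tens u + tens v.
Proof.
move=> [/sum_of_tprodsP[x ->] _]; exists (x ord0), (x (lift ord0 ord0)).
by rewrite !big_ord_recl big_ord0 addr0.
Qed.

Lemma rank2_neq_tens (A : tensor) x : has_rank A 2 -> A <> tens x.
Proof.
move=> [_ h] Ax; have : (2 <= 1)%N by apply: h; apply/sum_of_tprodsP; exists (fun _ => x); rewrite big_ord1.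
by [].
Qed.

Lemma rank2_nonvanishing (u v : coords) : has_rank (tens (W := W) u + tens v) 2 ->
  nonvanishing u /\ nonvanishing v.
Proof.
move=> r2; split; apply/tens_neq0 => z0.
  by apply: (@rank2_neq_tens _ v r2); rewrite z0 add0r.
by apply: (@rank2_neq_tens _ u r2); rewrite z0 addr0.
Qed.

Lemma good_rank_two (u v : coords) : (0 < d)%N -> good true u v -> rank_two (tens u + tens v).
Proof.
move=> d0 g; have r2 : has_rank (tens (W := W) u + tens v) 2.
  split.
    apply/sum_of_tprodsP; exists (fun k : 'I_2 => if k == ord0 then u else v).
    by rewrite !big_ord_recl big_ord0 addr0.
  move=> [|[|s]]// /sum_of_tprodsP[x].
    by rewrite big_ord0 -tens_zero// => E; case: (good_rank_gt1 d0 g E).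
  by rewrite big_ord1 => E; case: (good_rank_gt1 d0 g E).
split=> //; exists 2%N => //.
have [u0 v0] := rank2_nonvanishing r2.
pose x (k : 'I_2) : tensor := if k == ord0 then tens u else tens v.
exists (range x); split.
  exists x; split=> //; last by rewrite !big_ord_recl big_ord0 addr0.
  by move=> k; rewrite /x; case: ifP => _; apply/has_rank1P; [exists u|exists v].
move=> D [x' [rx' + ->]]; rewrite !big_ord_recl big_ord0 addr0.
have /has_rank1P[a _ aE] := rx' ord0; have /has_rank1P[b _ bE] := rx' (lift ord0 ord0).
have rangeE (f : 'I_2 -> tensor) : range f = [set f ord0; f (lift ord0 ord0)].
  apply/seteqP; split=> [_ [k _ <-]|_ [->|->]]; [|by exists ord0|by exists (lift ord0 ord0)].
  have [->|k0] := eqVneq k ord0; first by left.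
  by right; congr f; apply: val_inj; case: k k0 => [[|[|]]].
rewrite !rangeE /x /= aE bE => E.
have [ua|ub] := good_unique d0 g E.
  by rewrite -ua; congr [set _; _]; apply: (addrI (tens u)); rewrite E ua.
rewrite -ub setUC; congr [set _; _].
by apply: (addrI (tens u)); rewrite E addrC ub.
Qed.

Definition component (A y : tensor) := has_rank y 1 /\ has_rank (A - y) 1.

Lemma component_sum (u v : coords) : has_rank (tens (W := W) u + tens v) 2 ->
  component (tens u + tens v) (tens u).
Proof.
move=> r2; have [u0 v0] := rank2_nonvanishing r2.
by split; [|rewrite addrC addKr]; apply/has_rank1P; [exists u|exists v].
Qed.

Lemma componentP (A y : tensor) : component A y ->
  exists u v, [/\ y = tens u, A - y = tens v & A = tens u + tens v].
Proof.
move=> [/has_rank1P[u _ yu] /has_rank1P[v _ Av]]; exists u, v; split=> //.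
by rewrite -Av yu addrC subrK.
Qed.

Lemma component_two (A y z : tensor) : rank_two A -> component A y -> component A z ->
  z = y \/ z = A - y.
Proof.
move=> [r2 [r rr [D [_ Duniq]]]] cy cz.
have r_2 : r = 2%N by apply/eqP; rewrite eqn_leq (rr.2 _ r2.1) (r2.2 _ rr.1).
subst r.
have dec w : component A w -> D = range (fun k : 'I_2 => if k == ord0 then w else A - w).
  move=> [w1 w2]; apply: Duniq; exists (fun k : 'I_2 => if k == ord0 then w else A - w); split=> //.
    by move=> k; case: ifP.
  by rewrite !big_ord_recl big_ord0 addr0 /= addrC subrK.
have : range (fun k : 'I_2 => if k == ord0 then y else A - y) z.
  by rewrite -(dec y cy) (dec z cz); exists ord0.
by move=> [k _]; case: ifP => _ <-; [left|right].
Qed.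

(* If u_l and v_l were parallel for all l other than i and j, the identity
   u_i u_j + v_i v_j = (u_i + la v_i) u_j + v_i (v_j - la u_j)
   would provide too many components. *)
Lemma rank_two_good (u v : coords) : (1 < d)%N -> rank_two (tens u + tens v) -> good true u v.
Proof.
move=> d1 X; have [r2 _] := X; have [u0 v0] := rank2_nonvanishing r2.
split=> // _.
have main i j : i != j -> exists l, [/\ l != i, l != j & indep_at l u v].
  move=> ij; apply: contrapT => no.
  have par l : exists c : C, l != i -> l != j -> forall k, v l k = c * u l k.
    have [x ux] := u0 l; exists (v l x / u l x) => li lj y.
    apply: contrapT => vy; apply: no; exists l; split=> //; exists x, y.
    apply/eqP => e; apply: vy; apply: (mulfI ux); rewrite e; field; exact: ux.
  have /choice[c cP] := par.
  (* The scalars relating the parallel factors of [v] to those of [u], collected into one. *)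
  pose kap := \prod_(l | (l != i) && (l != j)) c l.
  have split2 (z : coords) m : tens (W := W) z m = z i (m i) * z j (m j) *
      \prod_(l | (l != i) && (l != j)) z l (m l).
    by rewrite /tens (bigD1 i)//= (bigD1 j) 1?eq_sym//= mulrA.
  have vE m : tens (W := W) v m = kap * v i (m i) * v j (m j) *
      \prod_(l | (l != i) && (l != j)) u l (m l).
    rewrite split2 (eq_bigr (fun l => c l * u l (m l))); last by move=> l /andP[li lj]; exact: cP.
    by rewrite big_split /= -/kap; ring.
  (* The direction along which the component moves: [tens (z la)] is [tens u] plus [la] times [e],
     so distinct [la] give distinct components once [e] is nonzero. *)
  pose e m := kap * v i (m i) * u j (m j) * \prod_(l | (l != i) && (l != j)) u l (m l).
  have [m em] : exists m : multi_index W, e m != 0.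
    have kap0 : kap != 0.
      apply/eqP => k0; move/tens_neq0: v0; apply; apply: tensor_eq => m.
      by rewrite vE k0 !mul0r.
    pose w : coords := fun l => if l == i then v l else u l.
    have w0 : nonvanishing w by move=> l; rewrite /w; case: ifP.
    apply: contrapT => /forallNP h; move/tens_neq0: w0; apply; apply: tensor_eq => m.
    have /negP := h m; rewrite negbK => /eqP em0.
    apply: (mulfI kap0); rewrite mulr0 -em0 split2 /w eqxx eq_sym (negbTE ij) /e.
    rewrite (eq_bigr (fun l => u l (m l))); last by move=> l /andP[/negbTE ->].
    by rewrite !mulrA.
  pose z (la : C) : coords := fun l k => if l == i then u l k + la * kap * v l k else u l k.
  pose z' (la : C) : coords := fun l k => if l == i then kap * v l k
     else if l == j then v l k - la * u l k else u l k.
  have zE la n : tens (W := W) (z la) n = tens u n + la * e n.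
    rewrite !split2 /z eqxx (eq_sym j) (negbTE ij).
    rewrite (eq_bigr (fun l => u l (n l))); last by move=> l /andP[/negbTE ->].
    by rewrite /e; ring.
  have AE la : tens (W := W) u + tens v = tens (z la) + tens (z' la).
    apply: tensor_eq => n; transitivity (tens (W := W) u n + tens (W := W) v n) => //.
    transitivity (tens (W := W) (z la) n + tens (W := W) (z' la) n) => //.
    rewrite zE vE (split2 (z' la)) /z' eqxx (eq_sym j) (negbTE ij) eqxx.
    rewrite [X in _ = _ + _ * _ * X](eq_bigr (fun l => u l (n l))); last first.
      by move=> l /andP[/negbTE -> /negbTE ->].
    by rewrite /e; ring.
  have comp la : component (tens u + tens v) (tens (z la)).
    by rewrite (AE la); apply: component_sum; rewrite -AE.
  have inj la mu : tens (W := W) (z la) = tens (z mu) -> la = mu.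
    by move=> /(congr1 (fun A : tensor => A m)); rewrite !zE => /addrI/(mulIf em).
  (* The values 0, 1, 2 of [la] give three distinct components, whereas there are only two. *)
  have h01 := component_two X (comp 0) (comp 1); have h02 := component_two X (comp 0) (comp 2%:R).
  have n01 : (1 : C) <> 0 by apply/eqP; exact: oner_neq0.
  have n02 : (2%:R : C) <> 0 by apply/eqP; rewrite pnatr_eq0.
  have n12 : (2%:R : C) <> 1 by apply/eqP; rewrite -subr_eq0 -[1]/(1%:R) -natrB// oner_neq0.
  case: h01 => [/inj//|h1]; case: h02 => [/inj//|h2].
  by apply: n12; apply: inj; rewrite h1.
(* For equal indices, avoiding a further index [k] as well is a stronger demand. *)
move=> i j; have [ij|] := eqVneq i j; last exact: main.
have [k ik] : exists k : 'I_d, i != k.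
  pose k0 : 'I_d := Ordinal (ltnW d1); pose k1 : 'I_d := Ordinal d1.
  have [->|] := eqVneq i k0; last by exists k0.
  by exists k1.
have [l [li _ luv]] := main i k ik.
by exists l; rewrite -ij.
Qed.

(** The map [Phi] from pairs to tensors is left abstract to serve both parts: it will be [tens u]
    for rank one and [tens u + tens v] for rank two. *)
Lemma good_loop_homotopic (b : bool) (X : set tensor) (Phi : coords -> coords -> tensor) :
  (0 < d)%N -> roomy N b ->
  (forall (S : topologicalType) (u v : S -> coords), coords_cont u -> coords_cont v ->
     forall m s, ccont s (fun x => Phi (u x) (v x) m)) ->
  (forall u v, good b u v -> X (Phi u v)) ->
  forall (x0 : set_type X) (p : loop (R := R) x0) (u v : R -> coords),
  coords_cont u -> coords_cont v -> (forall t : R, 0 <= t <= 1 -> good b (u t) (v t)) ->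
  (forall t : R, 0 <= t <= 1 -> Phi (u t) (v t) = set_val (p (clamp t))) ->
  u 0 = u 1 -> v 0 = v 1 -> homotopic p (cst_path x0).
Proof.
move=> d0 room cPhi PhiX x0 p u v cu cv guv uvp u01 v01.
have [Ku [Kv [cKu cKv gK [K0 [q1 [q2 K1]] Ks]]]] := good_loop_null d0 room cu cv guv u01 v01.
have PX (z : I * I) : Phi (Ku (uval z.1, uval z.2)) (Kv (uval z.1, uval z.2)) \in X.
  by rewrite inE; apply: PhiX; apply: gK; exact: uval_itv.
pose K (z : I * I) : set_type X := exist (fun A => A \in X) _ (PX z).
have cuv : continuous (fun z : I * I => (uval z.1, uval z.2) : R * R).
  by apply: cont_pair; apply: uval_comp_continuous => z; [exact: cvg_fst|exact: cvg_snd].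
have cKK (L : R * R -> coords) : coords_cont L -> coords_cont (fun z : I * I => L (uval z.1, uval z.2)).
  by move=> cL z j k; apply: (ccont_comp (cuv z) (cL _ j k)).
have cK : continuous K.
  by apply: cont_set_type; apply: tensor_continuous => m s; apply: cPhi; exact: cKK.
have PX2 : Phi q2 q1 \in X.
  have [<- <-] := K1 0; rewrite inE; apply: PhiX; apply: gK; last exact: itv01_one.
  by rewrite lexx ler01.
apply: (free_nullhomotopic (K := K) (c := exist (fun A => A \in X) _ PX2)) => //.
- move=> t; apply: val_inj => /=; rewrite uval_zero; have [-> ->] := K0 (uval t).
  by rewrite uvp ?uval_itv// clampK.
- by move=> t; apply: val_inj => /=; rewrite uval_one; have [-> ->] := K1 (uval t).
- by move=> s; apply: val_inj => /=; rewrite uval_zero uval_one; have [-> ->] := Ks (uval s).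
Qed.

Lemma ccont_Re (S : topologicalType) (f : S -> C) s : ccont s f ->
  {for s, continuous (fun x => complex.Re (f x) : R)}.
Proof.
move=> [cf]; apply/cvgrPdist_lt => e e0.
have eC : (0 : C) < e%:C by rewrite ltcR.
have /(@cvgrPdist_lt (R[i] : numFieldType) (R[i] : normedModType R[i]))/(_ _ eC) := cf.
apply: filterS => x fx; rewrite -ltcR (le_lt_trans _ fx)// -raddfB.
exact: normc_ge_Re.
Qed.

(** * The double cover of the rank-two identifiable tensors by their components *)

Section rank_two_cover.
Hypothesis d3 : (2 < d)%N.
Let d0 : (0 < d)%N. Proof. exact: ltn_trans d3. Qed.
Let d1 : (1 < d)%N. Proof. exact: ltn_trans d3. Qed.
Local Notation T := (set_type rank_two).

Let comp (A : T) (y : tensor) := component (set_val A) y.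
Let deck (A : T) (y : tensor) : tensor := set_val A - y.

Let TP (A : T) : rank_two (set_val A). Proof. exact: set_valP. Qed.

Let comp_ex A : exists y, comp A y.
Proof.
have [r2 _] := TP A; have [u [v E]] := rank2_sum r2.
by exists (tens u); rewrite /comp E; apply: component_sum; rewrite -E.
Qed.

Let deck_comp A y : comp A y -> comp A (deck A y).
Proof. by move=> [h1 h2]; split=> //; rewrite /deck subKr. Qed.

Let deck_neq A y : comp A y -> deck A y <> y.
Proof.
move=> /componentP[u [v [yu yv E]]]; rewrite /deck yv yu => vu.
have [r2 _] := TP A; move: r2; rewrite E vu => r2.
pose l0 : 'I_d := Ordinal d0.
apply: (@rank2_neq_tens _ (fun l k => if l == l0 then 2 * u l k else u l k) r2).
apply: tensor_eq => m; transitivity (tens (W := W) u m + tens (W := W) u m) => //.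
rewrite /tens (bigD1 l0)//= [in RHS](bigD1 l0)//= ?eqxx.
rewrite [X in _ = _ * X](eq_bigr (fun l => u l (m l))); last by move=> l /negbTE ->.
by ring.
Qed.

Let comp_two A y z : comp A y -> comp A z -> z = y \/ z = deck A y.
Proof. exact: component_two (TP A). Qed.

Let deck_cont : continuous (fun q : T * tensor => deck q.1 q.2).
Proof.
apply: tensor_continuous => m s; rewrite /deck.
rewrite (_ : (fun _ => _) = fun x : T * tensor => set_val x.1 m - x.2 m)//.
have c1 : continuous (fun x : T * tensor => set_val x.1 : tensor).
  by move=> x; apply: (@continuous_comp _ _ _ fst set_val); [exact: cvg_fst|exact: cont_set_val].
have c2 : continuous (fun x : T * tensor => x.2) by move=> x; exact: cvg_snd.
exact: (ccontB (tensor_coord_ccont m s c1) (tensor_coord_ccont m s c2)).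
Qed.

Let local_lift (A0 : T) y0 : comp A0 y0 -> exists s : T -> tensor,
  [/\ forall A, comp A (s A), s A0 = y0 & forall m, ccont A0 (fun A => s A m)].
Proof.
move=> /componentP[u [v [yu yv E]]].
have g : good true u v by apply: rank_two_good => //; rewrite -E.
have [||a [b [abE a0 ca]]] := @component_continuous _ _ _ T set_val A0 u v d0 g E.
- by move=> m; apply: tensor_coord_ccont; exact: cont_set_val.
- by move=> A; have [r2 _] := TP A; exact: rank2_sum.
exists (fun A => tens (a A)); split=> //; last by rewrite a0.
move=> A; rewrite /comp abE; apply: component_sum; rewrite -abE.
by have [] := TP A.
Qed.

(* The section selects the component y for which the m-th entry of y - (A - y)
   lies in a half plane around its value at the centre. *)
Let local_section (A0 : T) : exists s : T -> tensor,
  \forall A \near (A0 : T), comp A (s A) /\ {for A, continuous s}.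
Proof.
have [y0 c0] := comp_ex A0.
have [m ym] : exists m, y0 m - deck A0 y0 m != 0.
  apply: contrapT => /forallNP h; apply: (deck_neq c0); apply: tensor_eq => m.
  by have /negP := h m; rewrite negbK subr_eq0 => /eqP.
pose del (A : T) (y : tensor) : R := complex.Re ((y m - deck A y m) / (y0 m - deck A0 y0 m)).
have delN A y : del A (deck A y) = - del A y.
  rewrite /del; set D := _ - deck A0 y0 m.
  have -> : (deck A y m - deck A (deck A y) m) / D = - ((y m - deck A y m) / D).
    have -> : deck A (deck A y) = y by rewrite /deck subKr.
    by rewrite -mulNr opprB.
  by rewrite raddfN.
(* By [delN] at most one component has positive [del]; [s] picks it whenever there is one. *)
have ex A : exists y, comp A y /\ ((exists2 y', comp A y' & 0 < del A y') -> 0 < del A y).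
  have [[y' cy' dy']|no] := pselect (exists2 y', comp A y' & 0 < del A y').
    by exists y'.
  by have [y cy] := comp_ex A; exists y; split=> // -[z cz dz]; case: no; exists z.
have /choice[s sP] := ex; exists s.
have near A y : comp A y -> 0 < del A y -> exists s' : T -> tensor,
    [/\ s' A = y, forall k, ccont A (fun B => s' B k) & \forall B \near A, s B = s' B /\ 0 < del B (s' B)].
  move=> cy dy; have [s' [cs' s'A cont']] := local_lift cy.
  exists s'; split=> //.
  have cdel : ccont A (fun B => (s' B m - deck B (s' B) m) / (y0 m - deck A0 y0 m)).
    apply: ccontM; last exact: ccont_cst.
    apply: ccontB; first exact: cont'.
    exact: (ccontB (tensor_coord_ccont m A (@cont_set_val _ rank_two)) (cont' m)).
  have pos : \forall B \near A, 0 < del B (s' B).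
    have nb : nbhs (del A (s' A)) [set x : R | 0 < x].
      by rewrite s'A; apply: open_nbhs_nbhs; split; [exact: open_gt|exact: dy].
    exact: (ccont_Re cdel nb).
  apply: filterS pos => B dB; split=> //.
  have [csB dsB] := sP B; have {}dsB := dsB (ex_intro2 _ _ (s' B) (cs' B) dB).
  case: (comp_two (cs' B) csB) => // sB; move: dsB; rewrite sB delN oppr_gt0 => dneg.
  by have := lt_trans dB dneg; rewrite ltxx.
have d0' : 0 < del A0 y0 by rewrite /del divff//= ltr01.
have [s0 [_ _ n0]] := near A0 y0 c0 d0'.
apply: filterS n0 => A [sA dA]; split; first by have [] := sP A.
have csA : comp A (s A) by have [] := sP A.
(* The lift centred at [A0] is only known to be continuous there, so a second lift, centred at [A],
   is compared with [s]. *)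
have [s' [s'A cs' nA]] : exists s' : T -> tensor,
    [/\ s' A = s A, forall k, ccont A (fun B => s' B k) & \forall B \near A, s B = s' B /\ 0 < del B (s' B)].
  by apply: near => //; rewrite sA.
apply: tensor_continuous_at => k.
by apply: ccont_near_eq (cs' k); apply: filterS nA => B [-> _].
Qed.

Hypothesis room : roomy N true.

Let Phi (u v : coords) : tensor := tens u + tens v.

Let cPhi (S : topologicalType) (u v : S -> coords) : coords_cont u -> coords_cont v ->
  forall m s, ccont s (fun x => Phi (u x) (v x) m).
Proof. by move=> cu cv m s; apply: (ccontD (ccont_tens m s cu) (ccont_tens m s cv)). Qed.

Lemma rank_two_pi1 (x0 : T) : group_isomorphic (fundamental_group R T x0) 'Z_2.
Proof.
apply: (double_cover_pi1 (V := tensor) (comp := comp) (deck := deck)) => //.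
- exact: tensor_hausdorff.
- move=> p mp.
  have [y cy py] : exists2 y : R -> tensor, continuous y & forall t, comp (p (clamp t)) (y t).
    apply: (path_lift (V := tensor) (deck := deck)) => //; first exact: tensor_hausdorff.
    exact: path_continuous.
  have y01 : y 0 = y 1.
    apply: contrapT => y01; move/negP: mp; apply.
    by apply/asboolP; exists y.
  pose y' (t : R) : tensor := set_val (p (clamp t)) - y t.
  have cp : continuous (fun t : R => set_val (p (clamp t)) : tensor).
    move=> t; apply: (@continuous_comp _ _ _ (fun t => p (clamp t)) set_val); last exact: cont_set_val.
    exact: (loop_clamp_cont (p := p)).
  have cyt m t : ccont t (fun t => y t m) by exact: tensor_coord_ccont.
  have cyt' m t : ccont t (fun t => y' t m).
    by apply: ccontB => //; exact: (tensor_coord_ccont m t cp).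
  have [u [cu uy u01]] := rank1_loop_lift d0 cyt (fun t _ => (py t).1) y01.
  have y01' : y' 0 = y' 1.
    by rewrite /y' y01 (clamp_le0 (lexx 0)) (clamp_ge1 (lexx 1)) path_zero path_one.
  have [v [cv vy v01]] := rank1_loop_lift d0 cyt' (fun t _ => (py t).2) y01'.
  have uvp t : 0 <= t <= 1 -> Phi (u t) (v t) = set_val (p (clamp t)).
    by move=> t01; rewrite /Phi uy// vy// /y' addrC subrK.
  apply: (good_loop_homotopic (b := true) (Phi := Phi) d0 room cPhi _ (u := u) (v := v)) => //.
    by move=> a b; exact: good_rank_two.
  by move=> t t01; apply: rank_two_good => //; rewrite -/(Phi _ _) uvp//; exact: TP.
- have [r2 _] := TP x0; have [x [y E]] := rank2_sum r2.
  have g : good true x y by apply: rank_two_good => //; rewrite -E; exact: TP.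
  have [u [v [cu cv guv [u0 v0] [u1 v1]]]] := good_swap_path room d0 g.
  have PX (t : I) : Phi (u (uval t)) (v (uval t)) \in rank_two.
    by rewrite inE; apply: good_rank_two => //; apply: guv; exact: uval_itv.
  pose f (t : I) : T := exist (fun A => A \in rank_two) _ (PX t).
  have cI (w : R -> coords) : coords_cont w -> coords_cont (fun t : I => w (uval t)).
    by move=> cw t j k; apply: (ccont_comp (@uval_continuous R t) (cw _ j k)).
  have cf : continuous f.
    by apply: cont_set_type; apply: tensor_continuous => m s; apply: cPhi; exact: cI.
  have f0 : f zero = x0 by apply: val_inj; rewrite -[RHS]/(set_val x0) E /= uval_zero u0 v0.
  have f1 : f one = x0 by apply: val_inj; rewrite -[RHS]/(set_val x0) E /= uval_one u1 v1 /Phi addrC.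
  pose p : loop (R := R) x0 := mk_path cf f0 f1.
  exists p; apply/asboolP; exists (fun t => tens (u (clampi 0 1 t))); split.
  + apply: tensor_continuous => m t; apply: (@ccont_comp _ _ _ (clampi 0 1) (fun t => tens (u t) m)).
      exact: clampi_cont.
    exact: ccont_tens.
  + move=> t; rewrite /comp /=.
    have ct : uval (clamp t) = clampi 0 1 t by rewrite -clamp_clampi clampE// clampi_itv// ler01.
    rewrite /set_val /= ct; apply: component_sum; have [] // := good_rank_two d0 (guv _ (clampi_itv t ler01)).
  + rewrite !clampi_id ?lexx ?ler01// u0 u1 => xy.
    have cx : comp x0 (tens x) by rewrite /comp E; apply: component_sum; rewrite -E.
    by apply: (deck_neq cx); rewrite /deck E addrC addKr.
Qed.

End rank_two_cover.

Lemma rank_one_pi1 (x0 : set_type rank_one) : (0 < d)%N -> (forall j, 1 < \dim {: W j})%N ->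
  group_isomorphic (fundamental_group R (set_type rank_one) x0) unit.
Proof.
move=> d0 N1; have room : roomy N false by [].
have null (p : loop (R := R) x0) : homotopic p (cst_path x0).
  have cp : continuous (fun t : R => set_val (p (clamp t)) : tensor).
    move=> t; apply: (@continuous_comp _ _ _ (fun t => p (clamp t)) set_val); last exact: cont_set_val.
    by apply: path_comp_continuous; exact: clamp_continuous.
  have r1 t : has_rank (set_val (p (clamp t))) 1 by have := set_valP (p (clamp t)).
  have p01 : set_val (p (clamp 0)) = set_val (p (clamp 1)).
    by rewrite (clamp_le0 (lexx 0)) (clamp_ge1 (lexx 1)) path_zero path_one.
  have [w [cw wp w01]] := rank1_loop_lift d0 (fun m t => tensor_coord_ccont m t cp) (fun t _ => r1 t) p01.
  apply: (good_loop_homotopic (b := false) (Phi := fun u _ => tens u) d0 room _ _ (u := w) (v := w)) => //.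
  - by move=> S u v cu _ m s; exact: ccont_tens.
  - by move=> u v [u0 _ _]; apply/has_rank1P; exists u.
  - move=> t t01; have w0 : nonvanishing (w t).
      apply/tens_neq0; rewrite wp//; have /has_rank1P[z /tens_neq0 z0 ->] := r1 t; exact: z0.
    by split.
have all1 (a : fundamental_group R (set_type rank_one) x0) : a = 1%g.
  by rewrite -[a]reprK; apply/pi_homotopic; exact: null.
pose f (_ : fundamental_group R (set_type rank_one) x0) : unit := tt.
have fM : {morph f : x y / (x * y)%g >-> (x * y)%g} by [].
exists (HB.pack f (isMultiplicative.Build _ _ f fM) : {multiplicative (fundamental_group R (set_type rank_one) x0) -> unit}).
by exists (fun=> 1%g) => [a|[]//]; exact/esym/all1.
Qed.

End rank_two.

(** If d = 3, the sum is n_1 - 1, so every factor has at least three coordinates, two of which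
    differ from [c]. If d >= 4, some factor differs from [i], [j] and the factor of [c], and there
    two coordinates suffice. *)
Lemma roomy_true (d : nat) (n : 'I_d -> nat) : (2 < d)%N -> (forall j, 1 < n j)%N ->
  (forall j k : 'I_d, (j <= k)%N -> (n j <= n k)%N) ->
  (1 < \sum_(j < d | (j < d - 2)%N) (n j - 1))%N -> roomy n true.
Proof.
move=> d3 n1 mono sum; split=> // _ i j c.
have three l : (2 < n l)%N -> exists x y : 'I_(n l), [/\ x != y, cix x != c & cix y != c].
  move=> nl; pose o (k : nat) (h : (k < n l)%N) : 'I_(n l) := Ordinal h.
  have h0 : (0 < n l)%N by exact: ltn_trans nl.
  have h1 : (1 < n l)%N by exact: ltn_trans nl.
  have E (x y : 'I_(n l)) : cix x = cix y -> x = y.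
    by move=> /eqP; rewrite /cix eq_Tagged /= => /eqP.
  have [e0|e0] := eqVneq (cix (o _ h0)) c.
    exists (o _ h1), (o _ nl); rewrite -e0; split=> //; by apply/eqP => /E.
  have [e1|e1] := eqVneq (cix (o _ h1)) c.
    by exists (o _ h0), (o _ nl); rewrite e0 -e1; split=> //; apply/eqP => /E.
  by exists (o _ h0), (o _ h1).
have two l : l != tag c -> exists x y : 'I_(n l), [/\ x != y, cix x != c & cix y != c].
  move=> lc; have h0 : (0 < n l)%N by exact: ltnW.
  exists (Ordinal h0), (Ordinal (n1 l)).
  by split=> //; apply/eqP => e; move: lc; rewrite -e eqxx.
have [d_3|d4] := leqP d 3.
  have {}d_3 : d = 3%N by apply/eqP; rewrite eqn_leq d_3.
  subst d; have big l : (2 < n l)%N.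
    apply: (@leq_trans (n ord0)); last exact: mono.
    by move: sum; rewrite big_mkcond !big_ord_recl big_ord0 /= !addn0; case: (n ord0) => [|[|[|]]].
  have [l [li lj]] : exists l : 'I_3, l != i /\ l != j.
    have : (0 < #|~: [set i; j]|)%N.
      by rewrite cardsCs finset.setCK card_ord subn_gt0 cards2; case: (_ != _).
    by move=> /card_gt0P[l]; rewrite !inE negb_or => /andP[li lj]; exists l.
  by exists l; split=> //; exact: three.
have [l [li lj lc]] : exists l : 'I_d, [/\ l != i, l != j & l != tag c].
  have : (0 < #|~: [set i; j; tag c]|)%N.
    rewrite cardsCs finset.setCK card_ord subn_gt0 (leq_ltn_trans _ d4)//.
    by rewrite (leq_trans (leq_card_setU _ _))// cards1 addn1 ltnS cards2; case: (_ != _).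
  by move=> /card_gt0P[l]; rewrite !inE !negb_or => /andP[/andP[li lj] lc]; exists l.
by exists l; split=> //; exact: two.
Qed.

Theorem theorem6p1 (R : realType) (d : nat) (n : 'I_d -> nat)
    (W : 'I_d -> vectType R[i]) :
  (3 <= d)%N ->
  (forall j, \dim {: W j} = n j) ->
  (forall j, 2 <= n j)%N ->
  has_fundamental_group R
    (set_type [set A : tensor W | has_rank A 1]) unit
  /\
  ((forall j k : 'I_d, (j <= k)%N -> (n j <= n k)%N) ->
   (1 < \sum_(j < d | (j < d - 2)%N) (n j - 1))%N ->
   has_fundamental_group R
     (set_type [set A : tensor W | has_rank A 2 /\ identifiable A]) 'Z_2).
Proof.
move=> d3 dimW n2; have d0 : (0 < d)%N by exact: ltn_trans d3.
have N1 j : (1 < \dim {: W j})%N by rewrite dimW.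
have N0 j : (0 < \dim {: W j})%N by exact: ltnW.
split.
  split; last by move=> x0; exact: rank_one_pi1.
  have r1 : tens (fun (j : 'I_d) (_ : 'I_(\dim {: W j})) => 1) \in @rank_one R d W.
    rewrite inE; apply/has_rank1P; eexists; last by [].
    by move=> j; exists (Ordinal (N0 j)); exact: oner_neq0.
  by exists (exist (fun A => A \in @rank_one R d W) _ r1).
move=> mono sum.
have room : roomy (fun j => \dim {: W j}) true.
  apply: roomy_true => //; first by move=> j k jk; rewrite !dimW; exact: mono.
  by rewrite (eq_bigr (fun j => (n j - 1)%N)) // => j _; rewrite dimW.
split; last by move=> x0; exact: rank_two_pi1.
(* Nonemptiness: the sum of the product of all first basis vectors and that of all second ones,
   which are independent at every index. *)
pose u : @coords R d (fun j => \dim {: W j}) := fun j k => (k == Ordinal (N0 j))%:R.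
pose v : @coords R d (fun j => \dim {: W j}) := fun j k => (k == Ordinal (N1 j))%:R.
have uv j : indep_at j u v.
  by exists (Ordinal (N0 j)), (Ordinal (N1 j)); rewrite /u /v !eqxx /= mul1r mul0r oner_neq0.
have g : good true u v.
  split=> [j|j|_ i j].
  - by exists (Ordinal (N0 j)); rewrite /u eqxx oner_neq0.
  - by exists (Ordinal (N1 j)); rewrite /v eqxx oner_neq0.
  - have c0 : {c : cidx (fun j => \dim {: W j}) | true} by exists (cix (Ordinal (N0 (Ordinal d0)))).
    (* Only the existence of an index outside [i] and [j] is extracted here, so any coordinate may
       play the moving one. *)
    have [l [li lj _]] := room.2 isT i j (sval c0).
    by exists l.
have r2 : tens u + tens v \in @rank_two R d W by rewrite inE; exact: good_rank_two.
by exists (exist (fun A => A \in @rank_two R d W) _ r2).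
Qed.
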